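(* Let $r$ be a positive integer, $\gamma$ an $r$-core, and $\mathbf{RH}(\gamma)$ the set of partitions $\lambda$ with $\gamma\le_r\lambda$. Then, with indeterminates $X=(X_i)_{i\in\mathbb{N}}$ and $Y=(Y_j)_{j\in\mathbb{N}}$, $$\prod_{i,j\in\mathbb{N}}\prod_{k=0}^{r-1}\frac1{1-q^kX_iY_j}=\sum_{\lambda\in\mathbf{RH}(\gamma)}G^{(r)}_{\lambda/\gamma}(q^{1/2},X)\,G^{(r)}_{\lambda/\gamma}(q^{1/2},Y).$$
   Context: Partitions are identified with their Young diagrams (square $(i,j)$ in row $i$, column $j$, both numbered from $0$; rows numbered downwards). Diagonal $d_k$ is $\{(i,j):j-i=k\}$. For $\lambda\subset\mu$, $\mu/\lambda$ is an $r$-ribbon (written $\lambda\prec_r\mu$) if the skew diagram consists of exactly one square on each of $r$ consecutive diagonals; its head is its top-rightmost square, and its height is one less than the number of rows it meets. $\le_r$ is the reflexive transitive closure of $\prec_r$; an $r$-core is a minimal element for $\le_r$. $\mu/\lambda$ is a horizontal $r$-ribbon strip, written $\lambda\leftharpoondown_r\mu$, if there is a (possibly trivial) chain $\lambda=\lambda^{(0)}\prec_r\cdots\prec_r\lambda^{(p)}=\mu$ such that, with $d_{k_t}$ the diagonal containing the head of $\lambda^{(t)}/\lambda^{(t-1)}$, one has $k_1<k_2<\cdots<k_p$. The chain is then unique; put $|\mu/\lambda|_r=p$, and let $\mathrm{spin}(\mu/\lambda)$ be half the sum of the heights of the ribbons $\lambda^{(t)}/\lambda^{(t-1)}$. A semistandard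 $r$-ribbon tableau of shape $\lambda/\gamma$ is a finite sequence $P=(\gamma=\lambda^0\leftharpoondown_r\lambda^1\leftharpoondown_r\cdots\leftharpoondown_r\lambda^n=\lambda)$ (repetitions allowed), where sequences differing only by repetitions of $\lambda$ at the end are identified; $\mathrm{spin}(P)=\sum_j\mathrm{spin}(\lambda^{j+1}/\lambda^j)$ and $X^{\mathrm{wt}(P)}=\prod_jX_j^{|\lambda^{j+1}/\lambda^j|_r}$. Finally $$G^{(r)}_{\lambda/\gamma}(q^{1/2},X)=\sum_Pq^{\mathrm{spin}(P)}X^{\mathrm{wt}(P)}\in\mathbb{Z}[q^{1/2}][[X]],$$ summed over all semistandard $r$-ribbon tableaux $P$ of shape $\lambda/\gamma$; $G^{(r)}_{\lambda/\gamma}(q^{1/2},Y)$ is the same series in the indeterminates $Y_j$. *)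

(* Defs.v *)
From HB Require Import structures.
From Stdlib Require Import Relation_Operators.
From mathcomp Require Import all_boot all_order all_algebra.
From mathcomp Require Import finmap.
From mathcomp Require Import boolp classical_sets functions cardinality fsbigop.
From mathcomp Require Import monalg.

Set Implicit Arguments.
Unset Strict Implicit.
Unset Printing Implicit Defensive.

Import Order.TTheory GRing.Theory Num.Theory.

Local Open Scope classical_set_scope.
Local Open Scope ring_scope.

(* Power series in commuting indeterminates indexed by [I] (possibly infinite):
   all functions on monomials, a monomial being a finitely supported exponent
   function [I -> nat], with product [mmul] and unit [mone]. *)

Record fps (R : comNzRingType) (I : choiceType) :=
  FPS { fps_coef : {cmonom I} -> R }.

Arguments FPS {R I}.
Arguments fps_coef {R I}.

Section FPSRing.
Variables (R : comNzRingType) (I : choiceType).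
Local Notation fps := (fps R I).
Local Notation M := {cmonom I}.
Implicit Types (f g h : fps) (m : M).

HB.instance Definition _ := gen_eqMixin fps.
HB.instance Definition _ := gen_choiceMixin fps.

Lemma fpsP f g : (forall m, fps_coef f m = fps_coef g m) -> f = g.
Proof. by case: f g => [f] [g] /= fg; congr FPS; apply/funext. Qed.

Definition fps_zero : fps := FPS (fun=> 0).
Definition fps_opp f : fps := FPS (fun m => - fps_coef f m).
Definition fps_add f g : fps := FPS (fun m => fps_coef f m + fps_coef g m).

Fact fps_addA : associative fps_add.
Proof. by move=> f g h; apply: fpsP => m /=; rewrite addrA. Qed.
Fact fps_addC : commutative fps_add.
Proof. by move=> f g; apply: fpsP => m /=; rewrite addrC. Qed.
Fact fps_add0 : left_id fps_zero fps_add.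
Proof. by move=> f; apply: fpsP => m /=; rewrite add0r. Qed.
Fact fps_addN : left_inverse fps_zero fps_opp fps_add.
Proof. by move=> f; apply: fpsP => m /=; rewrite addNr. Qed.

HB.instance Definition _ :=
  GRing.isZmodule.Build fps fps_addA fps_addC fps_add0 fps_addN.

Definition fpsC (c : R) : fps := FPS (fun m => if m == mone then c else 0).
Definition fpsX (i : I) : fps := FPS (fun m => (m == ucm i)%:R).

Definition factorizations m : set (M * M) := [set ab | mmul ab.1 ab.2 = m].

Definition fps_mul f g : fps :=
  FPS (fun m => \sum_(ab \in factorizations m)
                   (fps_coef f ab.1 * fps_coef g ab.2)).

Lemma finite_divisors m : finite_set [set a : M | exists b, mmul a b = m].
Proof.
pose N := (\sum_(i <- finsupp m) m i)%N.
pose e (f : {ffun finsupp m -> 'I_N.+1}) : M :=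
  mkcmonom [fsfun i : finsupp m => nat_of_ord (f i) | 0%N].
apply: (@sub_finite_set _ _ (e @` setT)); last exact/finite_image/finite_finset.
move=> a [b ab]; exists [ffun i => inord (a (val i))] => //.
apply/eqP/cmP => i; rewrite /e cmE /=.
have am j : (a j <= m j)%N by rewrite -ab cmM leq_addr.
rewrite fsfun_ffun; case: insubP => /= [u ui uE|ni].
  rewrite ffunE inordK; first by rewrite uE.
  rewrite uE ltnS (leq_trans (am i))// /N (big_fsetD1 i)//= leq_addr//.
by apply/esym/eqP; rewrite -leqn0 (leq_trans (am i))// leqn0 cmE_eq0.
Qed.

Definition fps_divisors m : {fset M} := fset_set [set a | exists b, mmul a b = m].

Lemma fps_divisorsP m a : reflect (exists b, mmul a b = m) (a \in fps_divisors m).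
Proof.
rewrite in_fset_set; last exact: finite_divisors.
by apply: (iffP idP) => [/set_mem//|/mem_set].
Qed.

Lemma finite_factorizations m : finite_set (factorizations m).
Proof.
apply: (@sub_finite_set _ _ ([set a : M | exists b, mmul a b = m] `*`
                             [set a : M | exists b, mmul a b = m])).
  move=> [a b] /= ab; split; first by exists b.
  by exists a; rewrite mulmC.
by apply: finite_setX; apply: finite_divisors.
Qed.


(* The Cauchy product as a finite iterated sum over any finite set of monomials
   containing the divisors of [m]. *)
Lemma fps_coefM f g m (S : {fset M}) :
  (forall a, (exists b, mmul a b = m) -> a \in S) ->
  fps_coef (fps_mul f g) m =
  \sum_(a <- S) \sum_(b <- S | mmul a b == m) fps_coef f a * fps_coef g b.
Proof.
move=> mS /=.
rewrite (@fsbigE _ _ _ _ _ [seq ab <- [seq (a, b) | a <- S, b <- S]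
                           | mmul ab.1 ab.2 == m]).
- rewrite big_filter_cond big_mkcond big_allpairs; apply: eq_bigr => a _.
  rewrite [RHS]big_mkcond; apply: eq_bigr => b _ /=.
  case: eqP => [ab|_]; last by [].
  by rewrite /= mem_set.
- by rewrite filter_uniq// allpairs_uniq// => -[a b] [c d] _ _ [-> ->].
- by move=> [a b] /=; rewrite mem_filter => /andP[/eqP].
move=> [a b] /= ab; rewrite mem_filter /= ab eqxx /= => /negP[].
by apply/allpairsP; exists (a, b); split => //; apply: mS;
  [exists b | exists a; rewrite mulmC].
Qed.

Let divS m a : (exists b, mmul a b = m) -> a \in fps_divisors m.
Proof. by move/fps_divisorsP. Qed.

Fact fps_mulC : commutative fps_mul.
Proof.
move=> f g; apply: fpsP => m; rewrite !(fps_coefM _ _ (@divS m)).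
rewrite (exchange_big_dep xpredT) //=; apply: eq_bigr => a _.
by apply: eq_big => [b|b _]; [rewrite mulmC | rewrite mulrC].
Qed.

Let coefM3 f g h m :
  fps_coef (fps_mul f (fps_mul g h)) m =
  \sum_(a <- fps_divisors m) \sum_(b <- fps_divisors m)
    \sum_(c <- fps_divisors m | mmul a (mmul b c) == m)
      fps_coef f a * (fps_coef g b * fps_coef h c).
Proof.
rewrite (fps_coefM _ _ (@divS m)); apply: eq_bigr => a _.
transitivity (\sum_(x <- fps_divisors m | mmul a x == m)
    \sum_(b <- fps_divisors m) \sum_(c <- fps_divisors m | mmul b c == x)
      fps_coef f a * (fps_coef g b * fps_coef h c)).
  apply: eq_bigr => x /eqP ax.
  rewrite (@fps_coefM _ _ _ (fps_divisors m)) ?mulr_sumr; last first.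
    move=> b [c bc]; apply: divS; exists (mmul c a).
    by rewrite mulmA bc mulmC.
  by apply: eq_bigr => b _; rewrite mulr_sumr.
rewrite (exchange_big_dep xpredT)//=; apply: eq_bigr => b _.
rewrite (exchange_big_dep (fun c => mmul a (mmul b c) == m))/=; last first.
  by move=> x c /andP[/eqP ax _] /eqP bc; rewrite bc ax.
apply: eq_bigr => c /eqP abc.
rewrite (big_rem (mmul b c)) /=; last first.
  by apply: divS; exists a; rewrite mulmC.
rewrite abc !eqxx /= big1_seq ?addr0// => x /andP[/andP[_ /eqP <-]].
by rewrite mem_rem_uniqF ?fset_uniq.
Qed.

Fact fps_mulA : associative fps_mul.
Proof.
move=> f g h; rewrite [RHS]fps_mulC; apply: fpsP => m; rewrite !coefM3.
rewrite [RHS]exchange_big; apply: eq_bigr => a _.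
rewrite [RHS](exchange_big_dep xpredT)//=; apply: eq_bigr => b _.
apply: eq_big => [c|c _]; first by rewrite [mmul c _]mulmC mulmA.
by rewrite [RHS]mulrC mulrA.
Qed.

Fact fps_mul1 : left_id (fpsC 1) fps_mul.
Proof.
move=> f; apply: fpsP => m; rewrite (fps_coefM _ _ (@divS m)).
have mone_in : mone \in fps_divisors m by apply: divS; exists m; rewrite mul1m.
rewrite (big_rem mone)//= [X in _ + X]big1_seq ?addr0; last first.
  move=> a /andP[_ aS]; rewrite big1// => b _.
  case: eqP aS => [->|]; first by rewrite mem_rem_uniqF ?fset_uniq.
  by rewrite mul0r.
rewrite (big_rem m)/=; last by apply: divS; exists mone; rewrite mulm1.
rewrite mul1m !eqxx mul1r big1_seq ?addr0// => b /andP[].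
by rewrite mul1m => /eqP ->; rewrite mem_rem_uniqF ?fset_uniq.
Qed.

Fact fps_mulDl : left_distributive fps_mul fps_add.
Proof.
move=> f g h; apply: fpsP => m /=.
rewrite -[RHS]fsbig_split/=; last exact: finite_factorizations.
by apply: eq_fsbigr => ab _; rewrite mulrDl.
Qed.

Fact fps_1neq0 : fpsC 1 != fps_zero.
Proof.
apply/eqP => /(congr1 (fps_coef^~ mone)) /=; rewrite eqxx => /eqP.
by rewrite oner_eq0.
Qed.

HB.instance Definition _ := GRing.Zmodule_isComNzRing.Build fps
  fps_mulA fps_mulC fps_mul1 fps_mulDl fps_1neq0.

(* [f^-1] is the inverse of [f] whenever [f] is invertible, and [f] otherwise. *)
Definition fps_unit : pred fps := fun f => `[< exists g : fps, g * f = 1 >].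
Definition fps_inv f : fps :=
  if fps_unit f then xget f [set g | g * f = 1] else f.

Fact fps_mulV : {in fps_unit, left_inverse 1 fps_inv *%R}.
Proof.
move=> f uf; rewrite /fps_inv (uf : fps_unit f).
by case: xgetP => [g -> //|nof]; case/asboolP: uf => g /nof.
Qed.

Fact fps_unitP f g : g * f = 1 -> fps_unit f.
Proof. by move=> gf; apply/asboolP; exists g. Qed.

Fact fps_inv_out : {in [predC fps_unit], fps_inv =1 id}.
Proof. by move=> f nuf; rewrite /fps_inv (negbTE (nuf : ~~ fps_unit f)). Qed.

HB.instance Definition _ := GRing.ComNzRing_hasMulInverse.Build fps
  fps_mulV fps_unitP fps_inv_out.

End FPSRing.

Arguments fpsC {R I}.
Arguments fpsX {R I}.

(* Infinite sums and products converge coefficientwise, the coefficient ring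
   being discrete; products are limits along the finite subsets of [T], and no
   order on [T] is involved. [fps_sum A F] is the sum when [fps_summable A F],
   and [fps_prod F] the product when [fps_multipliable F]. *)

Section FPSInfinite.
Variables (R : comNzRingType) (I T : choiceType).
Implicit Types (A : set T) (F : T -> fps R I).

Definition fps_summable A F : Prop :=
  forall m, finite_set [set t | A t /\ fps_coef (F t) m != 0].

Definition fps_sum A F : fps R I :=
  FPS (fun m => \sum_(t \in A) fps_coef (F t) m).

Definition fps_has_prod F (p : fps R I) : Prop :=
  forall m, exists S0 : {fset T}, forall S : {fset T}, (S0 `<=` S)%fset ->
    fps_coef (\prod_(t <- S) F t) m = fps_coef p m.

Definition fps_multipliable F : Prop := exists p, fps_has_prod F p.

Definition fps_prod F : fps R I := xget 1 (fps_has_prod F).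

End FPSInfinite.

Definition is_part (s : seq nat) : bool := sorted geq s && (0%N \notin s).

Record intpart := IntPart { intpart_seq :> seq nat; intpartP : is_part intpart_seq }.

HB.instance Definition _ := [isSub for intpart_seq].
HB.instance Definition _ := [Choice of intpart by <:].

Definition part (lam : intpart) (i : nat) : nat := nth 0%N lam i.

Definition diagram (lam : intpart) : set (nat * nat) :=
  [set s | (s.2 < part lam s.1)%N].

Definition skew_diagram (lam mu : intpart) : set (nat * nat) :=
  diagram mu `\` diagram lam.

Definition square_content (s : nat * nat) : int := s.2%:Z - s.1%:Z.

Definition diagonal (k : int) : set (nat * nat) := [set s | square_content s = k].

Definition is_ribbon (r : nat) (lam mu : intpart) : Prop :=
  diagram lam `<=` diagram mu /\
  exists c : int, forall k : int,
    if c <= k < c + r%:Z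
    then exists s, skew_diagram lam mu `&` diagonal k = [set s]
    else skew_diagram lam mu `&` diagonal k = set0.

Definition prec (r : nat) : rel intpart := fun lam mu => `[< is_ribbon r lam mu >].

Definition rows_met (lam mu : intpart) : seq nat :=
  [seq i <- iota 0 (size mu) | (part lam i < part mu i)%N].

Definition ribbon_height (lam mu : intpart) : nat := (size (rows_met lam mu)).-1.

(* For a ribbon [mu / lam], the last square of the topmost row met is the only
   square that is both topmost and rightmost. *)
Definition ribbon_head (lam mu : intpart) : nat * nat :=
  let i := seq.head 0%N (rows_met lam mu) in (i, (part mu i).-1).

Definition ribbon_le (r : nat) : intpart -> intpart -> Prop :=
  clos_refl_trans intpart (prec r).

Definition is_core (r : nat) (gam : intpart) : Prop :=
  forall lam, ribbon_le r lam gam -> lam = gam.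

Definition RH (r : nat) (gam : intpart) : set intpart :=
  [set lam | ribbon_le r gam lam].

Definition strip_chain (r : nat) (lam mu : intpart) (c : seq intpart) : Prop :=
  [/\ path (prec r) lam c, last lam c = mu &
      sorted <%R (pairmap (fun a b => square_content (ribbon_head a b)) lam c)].

Definition horizontal_strip (r : nat) (lam mu : intpart) : Prop :=
  exists c, strip_chain r lam mu c.

(* Some chain witnessing that [mu / lam] is a horizontal [r]-ribbon strip; there
   is only one. *)
Definition the_chain (r : nat) (lam mu : intpart) : seq intpart :=
  xget [::] [set c | strip_chain r lam mu c].

Definition strip_size (r : nat) (lam mu : intpart) : nat :=
  size (the_chain r lam mu).

(* Spins are half-integers, and [twice_spin] is twice the spin: in
   [{poly int}], whose indeterminate ['X] stands for q^(1/2), the monomial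
   q^spin is ['X ^+ twice_spin]. *)
Definition twice_spin (r : nat) (lam mu : intpart) : nat :=
  sumn (pairmap ribbon_height lam (the_chain r lam mu)).

(* Finite sequences up to repetitions of their last term are encoded as
   eventually constant infinite sequences. *)
Definition ribbon_tableau (r : nat) (gam lam : intpart) (P : nat -> intpart)
    : Prop :=
  [/\ P 0%N = gam, forall j, horizontal_strip r (P j) (P j.+1) &
      exists n, forall j, (n <= j)%N -> P j = lam].

(* As a [ribbon_tableau] is eventually constant, this sum and the product in
   [tableau_weight] have only finitely many nontrivial terms. *)
Definition tableau_twice_spin (r : nat) (P : nat -> intpart) : nat :=
  \big[addn/0%N]_(j \in [set: nat]) twice_spin r (P j) (P j.+1).

Section RibbonFunction.
Variable I : choiceType.
Local Notation A := (fps {poly int} I).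

(* q^(1/2) *)
Definition qhalf : {poly int} := 'X.

Definition tableau_weight (r : nat) (P : nat -> intpart) (x : nat -> A) : A :=
  \big[*%R/1]_(j \in [set: nat]) x j ^+ strip_size r (P j) (P j.+1).

(* [x] is the family of indeterminates in which the series is written. Only
   finitely many tableaux have a given weight, so that the sum converges. *)
Definition ribbonG (r : nat) (lam gam : intpart) (x : nat -> A) : A :=
  fps_sum [set P | ribbon_tableau r gam lam P]
    (fun P => fpsC (qhalf ^+ tableau_twice_spin r P) * tableau_weight r P x).

End RibbonFunction.

(* Main.v *)
(* A ribbon added to [lam] moves one bead of its Maya diagram {lam_i - i} from a
   position p to p + r, and its height is the number of beads jumped over. With
   u_p the operator adding such a ribbon and d_p its adjoint, horizontal strips
   are generated by U(x) = ... (1 + x u_1) (1 + x u_0) (1 + x u_{-1}) ..., and D(y)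
   is its adjoint. Since u_p and d_p' commute for p <> p', everything reduces to
     (1 + y d_p) C(H_{p+1}) (1 + x u_p) = (1 + x u_p) C(H_p) (1 + y d_p),
   where H_p counts the beads in [p, p + r - 1] and
   C(h) = \prod_(k < h) 1 / (1 - q^k x y). Far to the right there is no bead and
   far to the left every position is occupied, whence
   D(y) U(x) = C(r) U(x) D(y). As D(y) fixes an r-core, the theorem follows by
   computing <U(x_K) ... U(x_0) gam, U(y_K) ... U(y_0) gam>. Each coefficient of the
   series only involves a finite window of positions. *)

Require Import Defs.
From Stdlib Require Import Relation_Operators.
From mathcomp Require Import all_boot all_order all_algebra.
From mathcomp Require Import finmap.
From mathcomp Require Import boolp classical_sets functions cardinality fsbigop.
From mathcomp Require Import monalg.
From mathcomp Require Import zify ring.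

Set Implicit Arguments.
Unset Strict Implicit.
Unset Printing Implicit Defensive.

Import Order.TTheory GRing.Theory Num.Theory.
Local Open Scope ring_scope.

(** * Partitions and the counting functions of their Maya diagrams *)

Lemma ltn_count_iota (P : pred nat) (B i : nat) :
  (forall j, P j.+1 -> P j) -> (forall j, (B <= j)%N -> ~~ P j) ->
  (i < count P (iota 0 B))%N = P i.
Proof.
move=> Pdec; elim: B i => [|B IHB] i PB.
  by rewrite /= ltn0; apply/esym/negbTE/PB.
have [PBB|nPB] := boolP (P B); last first.
  rewrite -(addn1 B) iotaD add0n count_cat /= (negbTE nPB) !addn0; apply: IHB => j.
  by rewrite leq_eqVlt => /predU1P[<- //|/PB].
have Pall j : (j <= B)%N -> P j.
  move=> /subnK; move: (B - j)%N => d; elim: d j => [|d IHd] j dB.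
    by rewrite -dB add0n in PBB.
  by apply/Pdec/IHd; rewrite addnS -addSn.
have -> : count P (iota 0 B.+1) = B.+1.
  rewrite -[RHS](size_iota 0); apply/eqP; rewrite -all_count.
  by apply/allP => j; rewrite mem_iota add0n ltnS; apply: Pall.
have [iB|iB] := leqP i B; first by rewrite ltnS iB Pall.
by rewrite (negbTE (PB _ iB)) ltnNge iB.
Qed.

Lemma part_mono (lam : intpart) (i j : nat) :
  (i <= j)%N -> (part lam j <= part lam i)%N.
Proof.
move=> ij; rewrite /part; have [|js] := leqP (size lam) j.
  by move=> /(nth_default _) ->.
case/andP: (intpartP lam) => lams _.
have tr : transitive geq by move=> a b c ab bc; apply: leq_trans bc ab.
by apply: (sorted_leq_nth tr leqnn 0%N lams) => //; rewrite inE (leq_ltn_trans ij).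
Qed.

Lemma part_gt0 (lam : intpart) (i : nat) : (0 < part lam i)%N = (i < size lam)%N.
Proof.
rewrite /part; have [|js] := leqP (size lam) i.
  by move=> /(nth_default _) ->.
case/andP: (intpartP lam) => _ n0; rewrite lt0n; apply/negP => /eqP E.
by case/negP: n0; rewrite -E mem_nth.
Qed.

Lemma intpart_ext (lam mu : intpart) : part lam =1 part mu -> lam = mu.
Proof.
move=> E; apply/val_inj/(@eq_from_nth _ 0%N) => [|i _]; last exact: E.
have [||//] := ltngtP (size lam) (size mu).
  by rewrite -part_gt0 -E part_gt0 ltnn.
by rewrite -part_gt0 E part_gt0 ltnn.
Qed.

Lemma intpart_of_diagram (D : nat -> nat -> bool) (B : nat) :
  (forall i j, D i j.+1 -> D i j) -> (forall i j, D i.+1 j -> D i j) ->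
  (forall i j, D i j -> (i < B)%N && (j < B)%N) ->
  exists lam : intpart, forall i j, (j < part lam i)%N = D i j.
Proof.
move=> Dj Di DB.
pose len i := count (D i) (iota 0 B).
have lenE i j : (j < len i)%N = D i j.
  apply: ltn_count_iota => [k|k Bk]; first exact: Dj.
  by apply/negP => /DB/andP[_]; rewrite ltnNge Bk.
pose n := count (fun i => 0 < len i)%N (iota 0 B).
have nE i : (i < n)%N = (0 < len i)%N.
  apply: ltn_count_iota => [k|k Bk]; rewrite !lenE; first exact: Di.
  by apply/negP => /DB; rewrite ltnNge Bk.
have lenS i : (len i.+1 <= len i)%N.
  by rewrite leqNgt; apply/negP; rewrite lenE => /Di; rewrite -lenE ltnn.
have pl : is_part (mkseq len n).
  apply/andP; split.
    by apply/(sortedP 0%N) => i; rewrite size_mkseq => lt; rewrite !nth_mkseq//; [exact: lenS | exact: ltnW].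
  by apply/negP => /mapP[i]; rewrite mem_iota add0n nE => /= + E; rewrite -E.
exists (IntPart pl) => i j; rewrite /part /= -lenE.
have [ni|ni] := leqP n i; last by rewrite nth_mkseq.
rewrite nth_default ?size_mkseq// ltn0; apply/esym/negbTE.
by have := nE i; rewrite ltnNge ni /= lt0n => /esym/negbFE/eqP ->.
Qed.

(* The number of beads of the Maya diagram [{lam_i - i}] to the right of [k];
   up to the constant [max 0 (- k)], the number of squares on diagonal [k]. *)
Definition rowcount (lam : intpart) (k : int) : nat :=
  count (fun i : nat => k < (part lam i)%:Z - i%:Z) (iota 0 (size lam + `|k|)%N).

(** The numbers [lam_i - i] strictly decrease, so the rows counted form an initial segment; it ends
    before [size lam + |k|] because a row [i] past the last part has its bead at [- i]. *)
Lemma ltn_rowcount (lam : intpart) (k : int) (i : nat) :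
  (i < rowcount lam k)%N = (k < (part lam i)%:Z - i%:Z).
Proof.
apply: (@ltn_count_iota (fun i : nat => k < (part lam i)%:Z - i%:Z)) => j.
  by have := part_mono lam (leqnSn j); lia.
by have := part_gt0 lam j; lia.
Qed.

Lemma rowcount_gt (lam : intpart) (k : int) (i : nat) :
  k < (part lam i)%:Z - i%:Z -> (i < rowcount lam k)%N.
Proof. by rewrite ltn_rowcount. Qed.

Lemma rowcount_le (lam : intpart) (k : int) (i : nat) :
  (part lam i)%:Z - i%:Z <= k -> (rowcount lam k <= i)%N.
Proof. by rewrite leNgt -ltn_rowcount -leqNgt. Qed.

Lemma part_rowcount (lam : intpart) (k : int) :
  (part lam (rowcount lam k))%:Z - (rowcount lam k)%:Z <= k.
Proof. by rewrite leNgt -ltn_rowcount ltnn. Qed.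

Lemma rowcount_mono (lam : intpart) (k l : int) :
  k <= l -> (rowcount lam l <= rowcount lam k)%N.
Proof. by move=> kl; apply/rowcount_le/(le_trans (part_rowcount lam k)). Qed.

Lemma rowcount_step (lam : intpart) (k : int) :
  (rowcount lam k <= rowcount lam (k - 1) <= (rowcount lam k).+1)%N.
Proof.
rewrite rowcount_mono/=; last by lia.
apply: rowcount_le; have := part_rowcount lam k.
have := part_mono lam (leqnSn (rowcount lam k)); lia.
Qed.

Lemma rowcount_lip (lam : intpart) (k l : int) :
  k <= l -> (rowcount lam k)%:Z <= (rowcount lam l)%:Z + (l - k).
Proof.
move=> kl; have -> : k = l - `|l - k|%N%:Z by lia.
elim: `|l - k|%N => [|n IHn]; first by rewrite subr0; lia.
have := rowcount_step lam (l - n%:Z).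
have -> : l - n%:Z - 1 = l - n.+1%:Z by lia.
lia.
Qed.

Lemma rowcount_inj (lam mu : intpart) : rowcount lam =1 rowcount mu -> lam = mu.
Proof.
move=> E; apply: intpart_ext => i.
have [lt|lt|//] := ltngtP (part lam i) (part mu i).
  have := @rowcount_gt mu ((part lam i)%:Z - i%:Z) i.
  by rewrite -E ltn_rowcount; lia.
have := @rowcount_gt lam ((part mu i)%:Z - i%:Z) i.
by rewrite E ltn_rowcount; lia.
Qed.

(** These conditions characterise counting functions of Maya diagrams: steps of 0 or 1, no bead far
    to the right, the values of the empty partition far to the left. The diagram sought has a square
    in row [i] of diagonal [k] when [i < f k]. *)
Lemma intpart_of_rowcount (f : int -> nat) (B : nat) :
  (forall k : int, (f k <= f (k - 1)%R <= (f k).+1)%N) ->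
  (forall k : int, B%:Z <= k -> f k = 0%N) ->
  (forall k : int, k <= - B%:Z -> (f k)%:Z = - k) ->
  exists lam : intpart, rowcount lam =1 f.
Proof.
move=> fstep ftop fbot.
pose D (i j : nat) := (i < f (j%:Z - i%:Z)%R)%N.
(* Rows are bounded by [B] because [f] is nonincreasing with value [B] at [- B], and columns by [2B]
   because moreover [j - i < B]. *)
have [||i j|lam lamE] := @intpart_of_diagram D (B + B)%N.
- move=> i j; rewrite /D => /leq_trans; apply.
  have := fstep (j.+1%:Z - i%:Z).
  have -> : j.+1%:Z - i%:Z - 1 = j%:Z - i%:Z by lia.
  lia.
- move=> i j; rewrite /D.
  have := fstep (j%:Z - i%:Z).
  have -> : j%:Z - i%:Z - 1 = j%:Z - i.+1%:Z by lia.
  lia.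
- rewrite /D => lt.
  have h1 : j%:Z - i%:Z < B%:Z.
    by rewrite ltNge; apply/negP => /ftop E; rewrite E in lt.
  have h2 : - B%:Z < j%:Z - i%:Z.
    by rewrite ltNge; apply/negP => /fbot E; move: lt; rewrite -ltz_nat E; lia.
  have fmono n : (f (n%:Z - B%:Z)%R <= B)%N.
    elim: n => [|n IHn]; first by have := fbot (0 - B%:Z); rewrite sub0r; lia.
    have := fstep (n.+1%:Z - B%:Z).
    have -> : n.+1%:Z - B%:Z - 1 = n%:Z - B%:Z by lia.
  lia.
  have := fmono (absz (j%:Z - i%:Z + B%:Z)).
  have -> : (absz (j%:Z - i%:Z + B%:Z))%:Z - B%:Z = j%:Z - i%:Z by lia.
  lia.
exists lam => k.
(* Both sides also count the rows [i] with [k + i < 0], whose square on diagonal [k] would have a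
   negative column; [key] treats genuine squares and [neg] these rows. *)
have key i : 0 <= k + i%:Z -> (i < rowcount lam k)%N = (i < f k)%N.
  move=> k0; have := lamE i (absz (k + i%:Z)); rewrite /D.
  have -> : (absz (k + i%:Z))%:Z - i%:Z = k by lia.
  by move=> <-; rewrite ltn_rowcount; lia.
have neg i : k + i%:Z < 0 -> (i < f k)%N && (i < rowcount lam k)%N.
  move=> k0; rewrite ltn_rowcount.
  have flip d : (B - d)%N%:Z <= (f (- (B - d)%N%:Z))%:Z.
    elim: d => [|d IHd]; first by rewrite fbot; lia.
    have [Bd|dB] := leqP B d; first by have -> : (B - d.+1 = 0)%N by lia.
    have := fstep (- (B - d.+1)%N%:Z).
    have -> : - (B - d.+1)%N%:Z - 1 = - (B - d)%N%:Z by lia.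
  lia.
  have [kB|kB] := leP k (- B%:Z); first by have := fbot _ kB; lia.
  have := flip (B - `|k|)%N; have -> : - (B - (B - `|k|))%N%:Z = k by lia.
  by lia.
have [lt|lt|//] := ltngtP (rowcount lam k) (f k).
  have := key (rowcount lam k); have := neg (rowcount lam k).
  by have [] := ltP (k + (rowcount lam k)%:Z) 0; lia.
have := key (f k); have := neg (f k).
by have [] := ltP (k + (f k)%:Z) 0; lia.
Qed.

(** * Ribbons in terms of the counting functions *)

(** In Maya terms, the bead of [lam] at [p] jumps to [p + r]. *)
Definition ribbon_at (r : nat) (p : int) (lam mu : intpart) : Prop :=
  forall k : int,
    rowcount mu k = (rowcount lam k + (p <= k < p + r%:Z)%R)%N.

Lemma diagram_rowcount (lam : intpart) (s : nat * nat) :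
  diagram lam s <-> (s.1 < rowcount lam (square_content s))%N.
Proof. by rewrite /diagram/square_content ltn_rowcount /=; split; lia. Qed.

Lemma diagram_subset (lam mu : intpart) :
  (diagram lam `<=` diagram mu)%classic <->
  forall k, (rowcount lam k <= rowcount mu k)%N.
Proof.
split=> [sub k|le s]; last by rewrite !diagram_rowcount => /leq_trans; apply.
rewrite leqNgt; apply/negP => lt.
have mu_lt := part_rowcount mu k; move: lt; set i := rowcount mu k in mu_lt * => lt.
have ki : square_content (i, absz (k + i%:Z)) = k by rewrite /square_content/=; lia.
have := sub (i, absz (k + i%:Z)); rewrite !diagram_rowcount ki /= => /(_ lt).
by rewrite ltnn.
Qed.

Lemma skew_diagonal (lam mu : intpart) (k : int) (s : nat * nat) :
  (skew_diagram lam mu `&` Defs.diagonal k)%classic s <->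
  square_content s = k /\ (rowcount lam k <= s.1 < rowcount mu k)%N.
Proof.
rewrite /skew_diagram/Defs.diagonal /=; split=> [[[mus lams] sk]|[sk /andP[le lt]]].
  split=> //; move: mus lams; rewrite !diagram_rowcount sk => -> /negP.
  by rewrite -leqNgt => ->.
by split=> //; split; rewrite diagram_rowcount sk//; apply/negP; rewrite -leqNgt.
Qed.

Lemma square_on_diagonal (lam : intpart) (k : int) (i : nat) :
  (rowcount lam k <= i)%N -> square_content (i, absz (k + i%:Z)) = k.
Proof.
move=> le; have h : ~~ (i < rowcount lam k)%N by rewrite -leqNgt.
by rewrite /square_content/=; move: h; rewrite ltn_rowcount; lia.
Qed.

(** On diagonal [k] the skew diagram fills the rows from [rowcount lam k] to [rowcount mu k - 1], so
    one square on each of [r] consecutive diagonals means that the count grows by one there and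
    nowhere else. *)
Lemma is_ribbonP (r : nat) (lam mu : intpart) :
  is_ribbon r lam mu <-> exists p, ribbon_at r p lam mu.
Proof.
split=> [[/diagram_subset sub [c cP]]|[p pP]].
  exists c => k; have := cP k; have := sub k.
  case: ifP => _; rewrite leq_eqVlt => /predU1P[E|lt].
  - move=> [s] /seteqP[_ /(_ s erefl)] /skew_diagonal[_].
    by rewrite E => /andP[/leq_ltn_trans lt /lt]; rewrite ltnn.
  - move=> [s] sE; apply/eqP; rewrite eqn_leq addn1 lt andbT leqNgt.
    apply/negP => lt2; have sin i : (rowcount lam k <= i < rowcount mu k)%N -> i = s.1.
      move=> /andP[h1 h2].
      have : (skew_diagram lam mu `&` Defs.diagonal k)%classic (i, absz (k + i%:Z)).
        by apply/skew_diagonal; rewrite (square_on_diagonal h1) h1 h2.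
      by rewrite sE => <-.
    have := sin (rowcount lam k); rewrite leqnn lt => /(_ isT) E.
    by have := sin (rowcount lam k).+1; rewrite leqnSn lt2 -E => /(_ isT); lia.
  - by rewrite E addn0.
  - move=> s0; have : (skew_diagram lam mu `&` Defs.diagonal k)%classic
      (rowcount lam k, absz (k + (rowcount lam k)%:Z)).
      by apply/skew_diagonal; rewrite (square_on_diagonal (leqnn _)) leqnn lt.
    by rewrite s0.
split; first by apply/diagram_subset => k; rewrite pP leq_addr.
exists p => k; have := pP k; case: ifP => _ /= E; last first.
  apply/seteqP; split=> // s /skew_diagonal[_]; rewrite E addn0.
  by move=> /andP[/leq_ltn_trans lt /lt]; rewrite ltnn.
exists (rowcount lam k, absz (k + (rowcount lam k)%:Z)); apply/seteqP; split=> s.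
  move=> /skew_diagonal; rewrite E; case: s => i j /= [h1 h2].
  have ia : i = rowcount lam k by lia.
  by rewrite -ia; congr (_, _); move: h1; rewrite /square_content /=; lia.
move=> ->; apply/skew_diagonal; rewrite (square_on_diagonal (leqnn _)) E.
by split=> //=; rewrite leqnn addn1 leqnn.
Qed.

(** Position [k] is occupied exactly when there are more beads beyond [k - 1] than beyond [k]. *)
Definition bead (lam : intpart) (k : int) : bool := (rowcount lam k < rowcount lam (k - 1))%N.

Lemma rowcount_bead (lam : intpart) (k : int) :
  rowcount lam (k - 1) = (rowcount lam k + bead lam k)%N.
Proof. by rewrite /bead; have := rowcount_step lam k; case: ltnP => /=; lia. Qed.

(** * Ribbons as jumps of a bead *)

Section Moves.
Variables (r : nat) (r_gt0 : (0 < r)%N).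
Implicit Types (lam mu kap : intpart) (p k : int).

(** Counts the beads strictly between [p] and [p + r], those passed by a jump between the two
    positions. *)
Definition leg p lam : nat := (rowcount lam p - rowcount lam (p + r%:Z - 1))%N.

(** The jumping bead has [b = rowcount lam p] beads to its right before the jump and
    [a = rowcount lam (p + r - 1)] after it. It passes from row [b] to row [a] and the beads passed
    shift down by one row, so exactly the rows from [a] to [b] grow longer. *)
Lemma rows_met_ribbon p lam mu : ribbon_at r p lam mu ->
  rows_met lam mu = iota (rowcount lam (p + r%:Z - 1)) (leg p lam).+1.
Proof.
move=> rib; set a := rowcount lam _; set b := rowcount lam p.
have ab : (a <= b)%N by apply: rowcount_mono; lia.
have key i : (part lam i < part mu i)%N = (a <= i <= b)%N.
  apply/idP/idP => [lt|/andP[ai ib]].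
    set k := (part lam i)%:Z - i%:Z.
    have h1 : (i < rowcount mu k)%N by rewrite ltn_rowcount /k; lia.
    have h2 : (rowcount lam k <= i)%N by apply: rowcount_le.
    have h3 : p <= k < p + r%:Z by apply: contraTT h1 => /negbTE E; rewrite rib E; lia.
    have h4 : rowcount lam k = i by move: h1; rewrite rib h3; lia.
    by rewrite -h4 /a /b !rowcount_mono//; lia.
  rewrite ltnNge; apply/negP => le; set k := (part lam i)%:Z - i%:Z.
  have h1 : (rowcount mu k <= i)%N by apply: rowcount_le; rewrite /k; lia.
  have h2 : (i < rowcount lam (k - 1))%N by rewrite ltn_rowcount /k; lia.
  have h3 := rowcount_step lam k.
  have [kp|pk] := leP k p.
    have h4 : (b <= rowcount lam k)%N by apply: rowcount_mono.
    have h5 : rowcount mu k = rowcount lam k by move: (rib k) h1; lia.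
    have h6 : (rowcount mu p <= i)%N.
      by apply: rowcount_le; rewrite -/k; move: kp; rewrite /k; lia.
    by move: h6; rewrite rib -/b; lia.
  have [kpr|kpr] := leP (p + r%:Z) k.
    have : (rowcount lam (k - 1) <= a)%N by apply: rowcount_mono; lia.
    by lia.
  by move: h1; rewrite rib; lia.
rewrite /rows_met /leg -/a -/b (eq_filter key).
have bs : (b < size mu)%N by rewrite -part_gt0; have := key b; rewrite ab leqnn; lia.
have -> : size mu = (a + ((b - a).+1 + (size mu - b.+1)))%N by lia.
rewrite !iotaD !filter_cat add0n.
rewrite (_ : filter _ (iota 0 a) = [::]); last first.
  by apply/eqP; rewrite -[_ == _]negbK -has_filter; apply/hasPn => i; rewrite mem_iota; lia.
rewrite (_ : filter _ (iota (a + _) _) = [::]); last first.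
  by apply/eqP; rewrite -[_ == _]negbK -has_filter; apply/hasPn => i; rewrite mem_iota; lia.
by rewrite cats0; apply/all_filterP/allP => i; rewrite mem_iota; lia.
Qed.

Lemma ribbon_height_at p lam mu : ribbon_at r p lam mu ->
  ribbon_height lam mu = leg p lam.
Proof. by move=> /rows_met_ribbon; rewrite /ribbon_height => ->; rewrite size_iota. Qed.

(** The head lies on the last diagonal of the ribbon, so heads on increasing diagonals amount to
    jumps from increasing positions. *)
Lemma ribbon_head_at p lam mu : ribbon_at r p lam mu ->
  square_content (ribbon_head lam mu) = p + r%:Z - 1.
Proof.
move=> rib; rewrite /ribbon_head (rows_met_ribbon rib) /=.
set a := rowcount lam _; rewrite /square_content /=.
have h1 : (a < rowcount mu (p + r%:Z - 1)%R)%N by rewrite rib -/a; lia.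
have h2 : ~~ (a < rowcount mu (p + r%:Z)%R)%N.
  have : (rowcount lam (p + r%:Z)%R <= a)%N by apply: rowcount_mono; lia.
  by rewrite rib; lia.
have := part_rowcount lam (p + r%:Z - 1).
by rewrite -/a; move: h1 h2; rewrite !ltn_rowcount; lia.
Qed.

(** Raising the count on [r] diagonals can violate the step condition only at [p] and [p + r], where
    the two hypotheses on beads prevent it. The bound [B] exceeds the first row, the first column
    and both ends of the jump. *)
Lemma ribbon_exists_up lam p : bead lam p -> ~~ bead lam (p + r%:Z) ->
  exists mu, ribbon_at r p lam mu.
Proof.
move=> bp nbp; pose f k := (rowcount lam k + (p <= k < p + r%:Z)%R)%N.
pose B := (size lam + part lam 0 + absz p + absz (p + r%:Z)%R + 1)%N.
apply: (@intpart_of_rowcount f B) => k.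
- rewrite /f; have := rowcount_step lam k; have := rowcount_bead lam k.
  move: bp nbp; have [->|/eqP kp] := eqVneq k p; first by move=> ->; lia.
  have [->|/eqP kpr] := eqVneq k (p + r%:Z); first by move=> _ /negbTE ->; lia.
  lia.
- move=> Bk; rewrite /f; have : (rowcount lam k <= 0)%N by apply: rowcount_le; lia.
  lia.
- move=> kB; rewrite /f.
  have : (rowcount lam k <= absz k)%N.
    by apply: rowcount_le; have := part_gt0 lam (absz k); lia.
  have : ((absz k).-1 < rowcount lam k)%N by apply: rowcount_gt; lia.
  lia.
Qed.

Lemma ribbon_exists_down mu p : ~~ bead mu p -> bead mu (p + r%:Z) ->
  exists lam, ribbon_at r p lam mu.
Proof.
move=> nbp bp; pose f k := (rowcount mu k - (p <= k < p + r%:Z)%R)%N.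
pose B := (size mu + part mu 0 + absz p + absz (p + r%:Z)%R + 1)%N.
have pos k : p <= k < p + r%:Z -> (0 < rowcount mu k)%N.
  move=> kp; have := rowcount_bead mu (p + r%:Z); rewrite bp => E.
  have : (rowcount mu (p + r%:Z - 1) <= rowcount mu k)%N by apply: rowcount_mono; lia.
  lia.
have [k|k|k|lam lamE] := @intpart_of_rowcount f B.
- rewrite /f; have := rowcount_step mu k; have := rowcount_bead mu k.
  have := pos k; have := pos (k - 1).
  move: bp nbp; have [->|/eqP kp] := eqVneq k p; first by move=> _ /negbTE ->; lia.
  have [->|/eqP kpr] := eqVneq k (p + r%:Z); first by move=> -> _; lia.
  lia.
- move=> Bk; rewrite /f; have : (rowcount mu k <= 0)%N by apply: rowcount_le; lia.
  lia.
- move=> kB; rewrite /f.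
  have : (rowcount mu k <= absz k)%N.
    by apply: rowcount_le; have := part_gt0 mu (absz k); lia.
  have : ((absz k).-1 < rowcount mu k)%N by apply: rowcount_gt; lia.
  lia.
by exists lam => k; rewrite lamE /f; have := pos k; case: (_ <= _ < _) => /=; lia.
Qed.

Lemma ribbon_bead p lam mu : ribbon_at r p lam mu ->
  [/\ bead lam p, ~~ bead lam (p + r%:Z), ~~ bead mu p & bead mu (p + r%:Z)].
Proof.
move=> rib; rewrite /bead !rib.
have := rowcount_step lam p; have := rowcount_step lam (p + r%:Z).
have := rowcount_step mu p; have := rowcount_step mu (p + r%:Z).
by rewrite !rib; split; lia.
Qed.

(* Moves the bead of the Maya diagram at [p] to [p + r], or conversely, when
   exactly one of the two positions is occupied. *)
Definition mv p lam : intpart :=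
  xget lam [set mu | ribbon_at r p lam mu \/ ribbon_at r p mu lam]%classic.

Lemma ribbon_mv_up p lam : bead lam p -> ~~ bead lam (p + r%:Z) ->
  ribbon_at r p lam (mv p lam).
Proof.
move=> h1 h2; rewrite /mv; case: xgetP => [mu _ [//|/ribbon_bead[_ _]]|no].
  by rewrite h1.
by case: (ribbon_exists_up h1 h2) => mu rib; case: (no mu); left.
Qed.

Lemma ribbon_mv_down p lam : ~~ bead lam p -> bead lam (p + r%:Z) ->
  ribbon_at r p (mv p lam) lam.
Proof.
move=> h1 h2; rewrite /mv; case: xgetP => [mu _ [/ribbon_bead[]|//]|no].
  by rewrite (negbTE h1).
by case: (ribbon_exists_down h1 h2) => mu rib; case: (no mu); right.
Qed.

Lemma mv_id p lam : bead lam p = bead lam (p + r%:Z) -> mv p lam = lam.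
Proof.
move=> E; rewrite /mv; case: xgetP => // mu _ [] /ribbon_bead[].
  by rewrite E => ->.
by rewrite E => _ _ /negbTE ->.
Qed.

Lemma mv_eq p lam mu : ribbon_at r p lam mu -> mv p lam = mu.
Proof.
move=> rib; case: (ribbon_bead rib) => h1 h2 _ _; apply: rowcount_inj => k.
by rewrite (ribbon_mv_up h1 h2) rib.
Qed.

Lemma mv_eq_down p lam mu : ribbon_at r p lam mu -> mv p mu = lam.
Proof.
move=> rib; case: (ribbon_bead rib) => _ _ h1 h2; apply: rowcount_inj => k.
by have := ribbon_mv_down h1 h2 k; rewrite (rib k) => /addIn.
Qed.

Lemma mvK p : involutive (mv p).
Proof.
move=> lam; case h1: (bead lam p); case h2: (bead lam (p + r%:Z)).
- by rewrite !mv_id// ?mv_id// h1 h2.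
- by apply: mv_eq_down; apply: ribbon_mv_up; rewrite ?h1 ?h2.
- by apply: mv_eq; apply: ribbon_mv_down; rewrite ?h1 ?h2.
- by rewrite !mv_id// ?mv_id// h1 h2.
Qed.

Lemma bead_ribbon p lam mu k : ribbon_at r p lam mu -> k != p -> k != p + r%:Z ->
  bead mu k = bead lam k.
Proof. by move=> rib; rewrite /bead !rib; lia. Qed.

Lemma bead_mv p lam k : k != p -> k != p + r%:Z -> bead (mv p lam) k = bead lam k.
Proof.
move=> kp kpr; case h1: (bead lam p); case h2: (bead lam (p + r%:Z)).
- by rewrite mv_id// h1 h2.
- by apply: (@bead_ribbon p) => //; apply: ribbon_mv_up; rewrite ?h1 ?h2.
- by apply/esym/(@bead_ribbon p) => //; apply: ribbon_mv_down; rewrite ?h1 ?h2.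
- by rewrite mv_id// h1 h2.
Qed.

Lemma bead_mv_l p lam : bead (mv p lam) p = bead lam (p + r%:Z).
Proof.
case h1: (bead lam p); case h2: (bead lam (p + r%:Z)).
- by rewrite mv_id// h1 h2.
- by case: (ribbon_bead (ribbon_mv_up (idP h1) (negbT h2))) => _ _ /negbTE.
- by case: (ribbon_bead (ribbon_mv_down (negbT h1) (idP h2))).
- by rewrite mv_id// h1 h2.
Qed.

Lemma bead_mv_r p lam : bead (mv p lam) (p + r%:Z) = bead lam p.
Proof. by rewrite -bead_mv_l mvK. Qed.

Lemma leg_mv p lam : leg p (mv p lam) = leg p lam.
Proof.
case h1: (bead lam p); case h2: (bead lam (p + r%:Z)).
- by rewrite mv_id// h1 h2.
- by rewrite /leg !(ribbon_mv_up (idP h1) (negbT h2)); lia.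
- have rib := ribbon_mv_down (negbT h1) (idP h2).
  by rewrite /leg [in RHS]rib [in X in _ = (_ - X)%N]rib; lia.
- by rewrite mv_id// h1 h2.
Qed.

End Moves.

(** * Operators adding and removing ribbons, and their commutation *)

Section Operators.
Variables (r : nat) (r_gt0 : (0 < r)%N) (A : comNzRingType) (t : A).
Implicit Types (lam mu : intpart) (p : int) (v w : intpart -> A) (x y : A).

(* [1 + x u_p] and [1 + y d_p], where [u_p] adds the ribbon occupying the
   diagonals [p, p + r - 1] with weight [t ^+ height] and [d_p] removes it. *)
Definition raise x p v : intpart -> A := fun lam => v lam +
  (if ~~ bead lam p && bead lam (p + r%:Z)
   then x * t ^+ leg r p lam * v (mv r p lam) else 0).

Definition lower y p v : intpart -> A := fun lam => v lam +
  (if bead lam p && ~~ bead lam (p + r%:Z)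
   then y * t ^+ leg r p lam * v (mv r p lam) else 0).

(** The number [H_p] of beads in the positions [p] to [p + r - 1]. *)
Definition window_beads p lam : nat :=
  (rowcount lam (p - 1) - rowcount lam (p + r%:Z - 1))%N.

Definition diag_op (c : nat -> A) p v : intpart -> A :=
  fun lam => c (window_beads p lam) * v lam.

(** If [p] and [p'] differ by [r], whichever jump is made first blocks the other and the mixed terms
    vanish. Otherwise the jumps involve four distinct positions and can be made in either order. *)
Lemma raise_lowerC x y p p' v : p != p' ->
  raise x p (lower y p' v) = lower y p' (raise x p v).
Proof.
move=> pp'; apply/funext => lam; rewrite /raise /lower.
have [p'E|np'] := eqVneq p' (p + r%:Z).
  have e1 : bead (mv r p lam) p' = bead lam p by rewrite p'E bead_mv_r.
  rewrite -p'E e1 (bead_mv_l r_gt0 p' lam).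
  case: (bead lam p); case: (bead lam p'); case: (bead lam (_ + _)) => /=;
    by rewrite ?andbF ?addr0 // addrAC.
have [pE|np] := eqVneq p (p' + r%:Z).
  have e1 : bead (mv r p' lam) p = bead lam p' by rewrite pE bead_mv_r.
  rewrite -pE e1 (bead_mv_l r_gt0 p lam).
  case: (bead lam p); case: (bead lam p'); case: (bead lam (_ + _)) => /=;
    by rewrite ?andbF ?addr0 // addrAC.
have nr : p + r%:Z != p' + r%:Z by lia.
rewrite !bead_mv// 1?eq_sym//.
case h1: (bead lam p); case h2: (bead lam (p + r%:Z)) => /=;
  rewrite ?addr0 //; case h3: (bead lam p'); case h4: (bead lam (p' + r%:Z)) => /=;
  rewrite ?addr0 //.
have d1 := ribbon_mv_down r_gt0 (negbT h1) h2.
have d2 := ribbon_mv_up r_gt0 h3 (negbT h4).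
have d3 : ribbon_at r p (mv r p (mv r p' lam)) (mv r p' lam).
  by apply: ribbon_mv_down => //; rewrite !bead_mv// ?h1 ?h2// 1?eq_sym.
have d4 : ribbon_at r p' (mv r p lam) (mv r p' (mv r p lam)).
  by apply: ribbon_mv_up => //; rewrite !bead_mv// ?h3 ?h4// 1?eq_sym.
have -> : mv r p (mv r p' lam) = mv r p' (mv r p lam).
  by apply: rowcount_inj => k; move: (d1 k) (d2 k) (d3 k) (d4 k); lia.
(* Each jump changes the leg of the other by the same amount, so the total height does not depend on
   the order. *)
have legE : (leg r p lam + leg r p' (mv r p lam) =
             leg r p' lam + leg r p (mv r p' lam))%N.
  have m2 : (rowcount (mv r p' lam) (p + r%:Z - 1)%R <= rowcount (mv r p' lam) p)%N.
    by apply: rowcount_mono; lia.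
  move: m2; rewrite /leg !d2 => m2.
  have m0 q : (rowcount lam (q + r%:Z - 1)%R <= rowcount lam q)%N.
    by apply: rowcount_mono; lia.
  have m1 q : (rowcount (mv r p lam) (q + r%:Z - 1)%R <= rowcount (mv r p lam) q)%N.
    by apply: rowcount_mono; lia.
  have := m0 p; have := m0 p'; have := m1 p'; have := d1 p; have := d1 p'.
  have := d1 (p + r%:Z - 1); have := d1 (p' + r%:Z - 1).
  move: pp' m2; lia.
have tE : t ^+ leg r p lam * t ^+ leg r p' (mv r p lam) =
          t ^+ leg r p' lam * t ^+ leg r p (mv r p' lam) by rewrite -!exprD legE.
move: (t ^+ leg r p lam) (t ^+ leg r p' (mv r p lam)) (t ^+ leg r p' lam)
  (t ^+ leg r p (mv r p' lam)) tE => a b a' b' tE.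
move: (v lam) (v (mv r p' lam)) (v (mv r p lam)) (v (mv r p' (mv r p lam))) => v0 v1 v2 v3.
by ring: tE.
Qed.

(** With [h] the leg at [p], the window counts at [p] and [p + 1] are [h] plus the occupation of
    [p], respectively of [p + r]. The operators only mix [lam] with [mv r p lam], and the four
    occupation patterns reduce to the recursion required of [c]. *)
Lemma raise_diag_lower x y c p v :
  (forall h, c h.+1 = c h + x * y * t ^+ h.*2 * c h.+1) ->
  lower y p (diag_op c (p + 1) (raise x p v)) =
  raise x p (diag_op c p (lower y p v)).
Proof.
move=> cP; apply/funext => lam; rewrite /raise /lower /diag_op.
have wl mu : window_beads p mu = (leg r p mu + bead mu p)%N.
  rewrite /window_beads /leg (rowcount_bead mu p).
  have : (rowcount mu (p + r%:Z - 1)%R <= rowcount mu p)%N by apply: rowcount_mono; lia.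
  lia.
have wr mu : window_beads (p + 1) mu = (leg r p mu + bead mu (p + r%:Z))%N.
  rewrite /window_beads /leg.
  have -> : p + 1 - 1 = p by lia.
  have -> : p + 1 + r%:Z - 1 = p + r%:Z by lia.
  have := rowcount_bead mu (p + r%:Z).
  have : (rowcount mu (p + r%:Z - 1)%R <= rowcount mu p)%N by apply: rowcount_mono; lia.
  lia.
rewrite !wl !wr !leg_mv// mvK// !bead_mv_l// !bead_mv_r//.
have /eqP := cP (leg r p lam); rewrite -addnn exprD -subr_eq => /eqP/esym.
move: (t ^+ leg r p lam) (v lam) (v (mv r p lam)) => a v0 v1.
by case: (bead lam p); case: (bead lam (p + r%:Z)) => E;
  rewrite /= ?addr0 ?addn0 ?addn1 ?E; ring.
Qed.

(** The product of the [1 + x u_p] for [p] from [a] to [a + m - 1], smallest position acting first;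
    [lowers] applies its factors in the opposite order, as the adjoint does. *)
Fixpoint raises x (a : int) (m : nat) v : intpart -> A :=
  if m is m'.+1 then raise x (a + m'%:Z) (raises x a m' v) else v.

Fixpoint lowers y (a : int) (m : nat) v : intpart -> A :=
  if m is m'.+1 then lowers y a m' (lower y (a + m'%:Z) v) else v.

Lemma raise_lowersC x y a m n v : (m <= n)%N ->
  raise x (a + n%:Z) (lowers y a m v) = lowers y a m (raise x (a + n%:Z) v).
Proof.
elim: m v => //= m IHm v mn; rewrite IHm ?raise_lowerC//; last exact: ltnW.
by apply/negP => /eqP; lia.
Qed.

Lemma raises_lowerC x y a m n v : (m <= n)%N ->
  raises x a m (lower y (a + n%:Z) v) = lower y (a + n%:Z) (raises x a m v).
Proof.
elim: m => //= m IHm mn; rewrite IHm ?raise_lowerC//; last exact: ltnW.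
by apply/negP => /eqP; lia.
Qed.

(** The two factors at the highest position carry the diagonal operator one place to the left and
    then commute with the remaining factors of the other kind; induction does the rest. *)
Lemma raises_diag_lowers x y c a m v :
  (forall h, c h.+1 = c h + x * y * t ^+ h.*2 * c h.+1) ->
  lowers y a m (diag_op c (a + m%:Z) (raises x a m v)) =
  raises x a m (diag_op c a (lowers y a m v)).
Proof.
move=> cP; elim: m v => [|m IHm] v /=; first by rewrite addr0.
have -> : a + m.+1%:Z = a + m%:Z + 1 by lia.
by rewrite raise_diag_lower// -raises_lowerC// -raise_lowersC// IHm.
Qed.

(** The involution [mv r p] permutes [F] and exchanges the partitions where [raise] contributes with
    those where [lower] does, so the sums agree term by term after reindexing. *)
Lemma raise_adjoint x p (F : seq intpart) v w : uniq F ->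
  (forall lam, lam \in F -> mv r p lam \in F) ->
  \sum_(lam <- F) raise x p w lam * v lam =
  \sum_(lam <- F) w lam * lower x p v lam.
Proof.
move=> Fu Fc; rewrite /raise /lower.
under eq_bigr do rewrite mulrDl; under [in RHS]eq_bigr do rewrite mulrDr.
rewrite !big_split /=; congr (_ + _).
have FF : perm_eq F (map (mv r p) F).
  have mvu : uniq (map (mv r p) F) by rewrite map_inj_uniq//; exact/inv_inj/mvK.
  apply: uniq_perm => // lam; apply/idP/mapP => [lF|[mu /Fc muF ->//]].
  by exists (mv r p lam); rewrite ?mvK//; exact: Fc.
rewrite (perm_big _ FF) big_map /=; apply: eq_bigr => lam _.
rewrite bead_mv_l// bead_mv_r// leg_mv// mvK//.
rewrite andbC; case: ifP => _; rewrite ?mul0r ?mulr0//; ring.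
Qed.

Lemma raises_adjoint x a m (F : seq intpart) v w : uniq F ->
  (forall p, a <= p < a + m%:Z -> forall lam, lam \in F -> mv r p lam \in F) ->
  \sum_(lam <- F) raises x a m w lam * v lam =
  \sum_(lam <- F) w lam * lowers x a m v lam.
Proof.
move=> Fu; elim: m v => //= m IHm v Fc.
rewrite raise_adjoint//; last by apply: Fc; lia.
by apply: IHm => p pam; apply: Fc; lia.
Qed.

End Operators.

(** * Truncation and order of formal power series *)

Section PowerSeries.
Variables (R : comNzRingType) (I : choiceType).
Implicit Types (f g h : fps R I) (m a b : {cmonom I}) (D : {cmonom I} -> Prop).

Lemma fps_coef_sum (T : Type) (s : seq T) (P : pred T) (F : T -> fps R I) m :
  fps_coef (\sum_(i <- s | P i) F i) m = \sum_(i <- s | P i) fps_coef (F i) m.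
Proof. exact: (big_morph (fun f : fps R I => fps_coef f m)). Qed.

Lemma fps_coefM_divisors f g m : fps_coef (f * g) m =
  \sum_(a <- fps_divisors m) \sum_(b <- fps_divisors m | mmul a b == m)
    fps_coef f a * fps_coef g b.
Proof. by apply: fps_coefM => a /fps_divisorsP. Qed.

Definition divisor_closed D := forall a b, D (mmul a b) -> D a.

(* Congruence modulo the ideal of the series without monomials in [D]. *)
Definition fps_eqmod D f g := forall m, D m -> fps_coef f m = fps_coef g m.

Lemma fps_eqmod_sym D f g : fps_eqmod D f g -> fps_eqmod D g f.
Proof. by move=> fg m /fg. Qed.

Lemma fps_eqmod_trans D g f h :
  fps_eqmod D f g -> fps_eqmod D g h -> fps_eqmod D f h.
Proof. by move=> fg gh m Dm; rewrite fg// gh. Qed.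

Lemma fps_eqmodD D f f' g g' :
  fps_eqmod D f f' -> fps_eqmod D g g' -> fps_eqmod D (f + g) (f' + g').
Proof. by move=> ff' gg' m Dm /=; rewrite ff'// gg'. Qed.

Lemma fps_eqmod_sum D (T : Type) (s : seq T) (P : pred T) (F G : T -> fps R I) :
  (forall i, P i -> fps_eqmod D (F i) (G i)) ->
  fps_eqmod D (\sum_(i <- s | P i) F i) (\sum_(i <- s | P i) G i).
Proof.
by move=> FG m Dm; rewrite !fps_coef_sum; apply: eq_bigr => i Pi; apply: FG.
Qed.

Lemma fps_eqmodM D f f' g g' : divisor_closed D ->
  fps_eqmod D f f' -> fps_eqmod D g g' -> fps_eqmod D (f * g) (f' * g').
Proof.
move=> Dc ff' gg' m Dm; rewrite !fps_coefM_divisors; apply: eq_bigr => a _.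
apply: eq_bigr => b /eqP ab; rewrite ff' ?gg'//.
  by apply: (Dc _ a); rewrite mulmC ab.
by apply: (Dc _ b); rewrite ab.
Qed.

Lemma fps_eqmod_prod D (T : Type) (s : seq T) (P : pred T) (F G : T -> fps R I) :
  divisor_closed D -> (forall i, P i -> fps_eqmod D (F i) (G i)) ->
  fps_eqmod D (\prod_(i <- s | P i) F i) (\prod_(i <- s | P i) G i).
Proof.
move=> Dc FG; apply: (big_ind2 (fps_eqmod D)) => // f f' g g'; exact: fps_eqmodM.
Qed.

Definition fps_ord_ge (n : nat) f := forall m, (mdeg m < n)%N -> fps_coef f m = 0.

Lemma fps_ord_geD n f g : fps_ord_ge n f -> fps_ord_ge n g -> fps_ord_ge n (f + g).
Proof. by move=> fn gn m mn /=; rewrite fn// gn// addr0. Qed.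

Lemma fps_ord_geM n p f g :
  fps_ord_ge n f -> fps_ord_ge p g -> fps_ord_ge (n + p) (f * g).
Proof.
move=> fn gp m mnp; rewrite fps_coefM_divisors big1// => a _.
rewrite big1// => b /eqP ab; move: mnp; rewrite -ab mdegM => mnp.
have [an|na] := ltnP (mdeg a) n; first by rewrite fn ?mul0r.
by rewrite gp ?mulr0//; lia.
Qed.

Lemma fps_ord_ge0 f : fps_ord_ge 0 f. Proof. by []. Qed.

Lemma fps_ord_geX (i : I) : fps_ord_ge 1 (fpsX i : fps R I).
Proof.
move=> m; rewrite ltnS leqn0 mdeg_eq0 => /eqP -> /=.
by rewrite eq_sym cm1_eq1.
Qed.

Lemma fps_ord_ge_exp n f : fps_ord_ge 1 f -> fps_ord_ge n (f ^+ n).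
Proof.
move=> f1; elim: n => [|n IHn]; first exact: fps_ord_ge0.
by rewrite exprS -add1n; apply: fps_ord_geM.
Qed.

Lemma divisor_closed_mdeg d : divisor_closed (fun m => (mdeg m < d)%N).
Proof. by move=> a b; rewrite mdegM; apply: leq_ltn_trans; apply: leq_addr. Qed.

(** The inverse is the geometric series; its coefficient at [m] is read off the partial sum with
    [mdeg m + 1] terms, since later powers have too high an order. *)
Lemma unit_one_sub f : fps_ord_ge 1 f -> 1 - f \is a GRing.unit.
Proof.
move=> f1; pose S n : fps R I := \sum_(k < n) f ^+ k.
pose g : fps R I := FPS (fun m => fps_coef (S (mdeg m).+1) m).
have gS n : fps_eqmod (fun m => (mdeg m < n)%N) g (S n).
  move=> m mn /=; rewrite /S -(subnKC mn) big_split_ord /=.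
  rewrite -[LHS]addr0; congr (_ + _); apply/esym.
  rewrite fps_coef_sum big1// => k _; apply: (fps_ord_ge_exp (n := (mdeg m).+1 + k)) => //.
  by lia.
have gf : (1 - f) * g = 1.
  apply: fpsP => m; pose n := (mdeg m).+1.
  have mn : (mdeg m < n)%N by [].
  have H : fps_eqmod (fun m => (mdeg m < n)%N) ((1 - f) * g) ((1 - f) * S n).
    by apply: fps_eqmodM => //; apply: divisor_closed_mdeg.
  rewrite (H _ mn) /S -opprB mulNr -subrX1 opprB /=.
  by rewrite (fps_ord_ge_exp (n := n)) ?oppr0 ?addr0.
by apply/unitrP; exists g; rewrite mulrC.
Qed.

Lemma inv_one_sub f : fps_ord_ge 1 f -> (1 - f)^-1 = 1 + f * (1 - f)^-1.
Proof.
move=> /unit_one_sub u; apply: (mulrI u).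
by rewrite mulrDr mulr1 mulrCA divrr// mulr1 subrK.
Qed.

Lemma fps_eqmod_inv D f : divisor_closed D -> fps_ord_ge 1 f ->
  fps_eqmod D f 0 -> fps_eqmod D (1 - f)^-1 1.
Proof.
move=> Dc f1 f0; rewrite inv_one_sub// -[X in fps_eqmod _ _ X]addr0.
apply: fps_eqmodD => //; rewrite -[X in fps_eqmod _ _ X](mul0r (1 - f)^-1).
exact: fps_eqmodM.
Qed.

End PowerSeries.

(** * Finite boxes of partitions *)

Definition box (B : nat) (lam : intpart) : bool :=
  (part lam 0 <= B)%N && (size lam <= B)%N.

(** In Maya terms, no bead lies to the right of [B] and every position up to [- B] is occupied. *)
Lemma box_rowcount (B : nat) (lam : intpart) :
  box B lam = (rowcount lam B%:Z == 0%N) && (rowcount lam (- B%:Z)%R <= B)%N.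
Proof.
have h1 := ltn_rowcount lam B%:Z 0; have h2 := ltn_rowcount lam (- B%:Z) B.
by have := part_gt0 lam B; rewrite /box; lia.
Qed.

Lemma rowcount_ge (lam : intpart) (k : int) : - k <= (rowcount lam k)%:Z.
Proof.
have [k0|k0] := leP 0 k; first by lia.
have : ((absz k).-1 < rowcount lam k)%N by apply: rowcount_gt; lia.
lia.
Qed.

Lemma box_ribbon_up (r : nat) (p : int) (B : nat) (kap lam : intpart) :
  (0 < r)%N -> ribbon_at r p kap lam -> box B kap -> box (B + r) lam.
Proof.
move=> r_gt0 rib; rewrite !box_rowcount !rib => /andP[/eqP top bot].
have [] := ribbon_bead r_gt0 rib; rewrite /bead => b1 b2 _ _.
have := rowcount_step kap (p + r%:Z).
have h1 : (rowcount kap (B + r)%N%:Z <= rowcount kap B%:Z)%N by apply: rowcount_mono; lia.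
have h2 : (rowcount kap (- (B + r)%N%:Z)%R <= rowcount kap (- B%:Z)%R + r)%N.
  have := @rowcount_lip kap (- (B + r)%N%:Z) (- B%:Z); lia.
move=> h3; have h4 : p <= B%:Z.
  rewrite leNgt; apply/negP => Bp; have : (rowcount kap (p - 1)%R <= rowcount kap B%:Z)%N.
    by apply: rowcount_mono; lia.
  lia.
apply/andP; split; first lia.
have [pB|] := boolP (p <= - (B + r)%N%:Z < p + r%:Z); last by lia.
have := @rowcount_lip kap (- (B + r)%N%:Z) (p + r%:Z - 1).
have := @rowcount_lip kap (p + r%:Z) (- B%:Z).
lia.
Qed.

Lemma box_sub (B : nat) (kap lam : intpart) :
  (forall k, (rowcount kap k <= rowcount lam k)%N) -> box B lam -> box B kap.
Proof.
move=> le; rewrite !box_rowcount; have := le B%:Z; have := le (- B%:Z); lia.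
Qed.

Lemma box_ribbon_down (r : nat) (p : int) (B : nat) (kap lam : intpart) :
  ribbon_at r p kap lam -> box B lam -> box B kap.
Proof. by move=> rib; apply: box_sub => k; rewrite rib leq_addr. Qed.

(** The ribbon avoids the diagonals [B] and [- B], whose counts decide membership in the box. *)
Lemma box_ribbon (r : nat) (p : int) (B : nat) (kap lam : intpart) :
  - B%:Z < p -> p + r%:Z <= B%:Z -> ribbon_at r p kap lam -> box B kap = box B lam.
Proof. by move=> h1 h2 rib; rewrite !box_rowcount !rib; lia. Qed.

Lemma finite_box (B : nat) : finite_set [set lam | box B lam]%classic.
Proof.
have nilP : is_part [::] by [].
pose e (f : {ffun 'I_B -> 'I_B.+1}) : intpart := xget (IntPart nilP)
  [set lam | box B lam /\ forall i : 'I_B, part lam i = f i]%classic.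
apply: (@sub_finite_set _ _ (e @` setT)%classic); last exact/finite_image/finite_finset.
move=> lam /= boxl; have lamB i : (part lam i < B.+1)%N.
  by rewrite ltnS (leq_trans (part_mono lam (leq0n i))); case/andP: boxl.
exists [ffun i : 'I_B => inord (part lam i)] => //; rewrite /e.
case: xgetP => [mu _ /= [boxm muE]|/(_ lam)[]]; last first.
  by split=> // i; rewrite ffunE inordK.
apply: intpart_ext => i; have [iB|Bi] := ltnP i B.
  by rewrite (muE (Ordinal iB)) ffunE inordK.
rewrite /part !nth_default//.
  by apply: leq_trans Bi; case/andP: boxl.
by apply: leq_trans Bi; case/andP: boxm.
Qed.

Definition box_seq (B : nat) : seq intpart :=
  fset_set [set lam | box B lam]%classic.

Lemma mem_box_seq (B : nat) (lam : intpart) : (lam \in box_seq B) = box B lam.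
Proof.
rewrite /box_seq in_fset_set; last exact: finite_box.
by apply/idP/idP => [/set_mem|boxl]//; apply/mem_set.
Qed.

Lemma uniq_box_seq (B : nat) : uniq (box_seq B).
Proof. exact: fset_uniq. Qed.

(** * Commutation of the strip operators in a finite window *)

Section Cauchy.
Variables (r : nat) (r_gt0 : (0 < r)%N) (I : choiceType).
Variables (R : comNzRingType) (t : R).
Local Notation A := (fps R I).
Implicit Types (lam mu : intpart) (p : int) (v w : intpart -> A) (x y : A).

Local Notation up := (raise r (fpsC t : A)).
Local Notation down := (lower r (fpsC t : A)).
Local Notation ups := (raises r (fpsC t : A)).
Local Notation downs := (lowers r (fpsC t : A)).

(** The scalar [C(h)], with [t] standing for the square root of [q]. *)
Definition cauchy_factor x y (h : nat) : A :=
  \prod_(k < h) (1 - fpsC (t ^+ 2) ^+ k * x * y)^-1.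

Lemma fpsC_exp (c : R) n : fpsC c ^+ n = fpsC (c ^+ n) :> A.
Proof.
elim: n => [|n IHn]; first by rewrite !expr0.
rewrite !exprS IHn; apply: fpsP => m; rewrite fps_coefM_divisors /=.
have m1 : mone \in fps_divisors m by apply/fps_divisorsP; exists m; rewrite mul1m.
rewrite (big_rem mone)//= [X in _ + X]big1_seq ?addr0; last first.
  move=> a /andP[_]; rewrite mem_rem_uniq ?fset_uniq// inE => /andP[/negbTE -> _].
  by rewrite big1// => b _; rewrite mul0r.
have mm : m \in fps_divisors m by apply/fps_divisorsP; exists mone; rewrite mulm1.
rewrite (big_rem m)//= mul1m !eqxx big1_seq ?addr0.
  by case: eqP; rewrite ?mulr0.
move=> b /andP[]; rewrite mul1m => /eqP ->.
by rewrite mem_rem_uniq ?fset_uniq// inE eqxx.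
Qed.

Lemma ord_cauchy x y (q : A) : fps_ord_ge 1 x -> fps_ord_ge 1 (q * x * y).
Proof.
move=> x1; rewrite -mulrA mulrCA -[1%N]addn0.
by apply: fps_ord_geM => //; apply: fps_ord_ge0.
Qed.

(** This is the recursion that the local commutation relation requires; it comes from
    [1 / (1 - z) = 1 + z / (1 - z)] for the last factor. *)
Lemma cauchy_factorS x y h : fps_ord_ge 1 x ->
  cauchy_factor x y h.+1 =
  cauchy_factor x y h + x * y * fpsC t ^+ h.*2 * cauchy_factor x y h.+1.
Proof.
move=> x1; have u := unit_one_sub (ord_cauchy y (fpsC (t ^+ 2) ^+ h) x1).
rewrite /cauchy_factor big_ord_recr /= -/(cauchy_factor x y h).
set c := cauchy_factor x y h.
have -> : x * y * fpsC t ^+ h.*2 = fpsC (t ^+ 2) ^+ h * x * y.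
  by rewrite -mul2n exprM -(fpsC_exp t 2) mulrC mulrA.
set z := _ * x * y in u *.
by rewrite -{2}[c]mulr1 mulrCA -mulrDr -inv_one_sub//; apply: ord_cauchy.
Qed.

Definition vec_eqmod (D : {cmonom I} -> Prop) v w :=
  forall lam, fps_eqmod D (v lam) (w lam).

Section Congruence.
Variables (D : {cmonom I} -> Prop) (Dc : divisor_closed D).

Lemma raise_eqmod x p v w : vec_eqmod D v w -> vec_eqmod D (up x p v) (up x p w).
Proof.
move=> vw lam; apply: fps_eqmodD; first exact: vw.
by case: ifP => // _; apply: fps_eqmodM.
Qed.

Lemma lower_eqmod x p v w : vec_eqmod D v w -> vec_eqmod D (down x p v) (down x p w).
Proof.
move=> vw lam; apply: fps_eqmodD; first exact: vw.
by case: ifP => // _; apply: fps_eqmodM.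
Qed.

Lemma raises_eqmod x a m v w :
  vec_eqmod D v w -> vec_eqmod D (ups x a m v) (ups x a m w).
Proof. by move=> vw; elim: m => //= m IHm; apply: raise_eqmod. Qed.

Lemma lowers_eqmod x a m v w :
  vec_eqmod D v w -> vec_eqmod D (downs x a m v) (downs x a m w).
Proof. by elim: m v w => //= m IHm v w vw; apply/IHm/lower_eqmod. Qed.

End Congruence.

Lemma raise_scale x p (c : A) v :
  up x p (fun lam => c * v lam) = fun lam => c * up x p v lam.
Proof.
apply/funext => lam; rewrite /raise mulrDr; congr (_ + _).
by case: ifP => _; rewrite ?mulr0// mulrCA.
Qed.

Lemma raises_scale x a m (c : A) v :
  ups x a m (fun lam => c * v lam) = fun lam => c * ups x a m v lam.
Proof. by elim: m => //= m ->; rewrite raise_scale. Qed.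

(* [v] is supported near the box [T] up to terms of high order. *)
Definition spread (T : nat) v := forall j lam, ~~ box (T + r * j) lam ->
  fps_ord_ge j.+1 (v lam).

(** An added ribbon enlarges the box by at most [r] and brings a factor [x] of order 1. The box
    needed thus depends on the order alone, not on the number of operators applied. *)
Lemma spread_raise T x p v : fps_ord_ge 1 x -> spread T v -> spread T (up x p v).
Proof.
move=> x1 vT j lam nb; apply: fps_ord_geD; first exact: vT.
case: ifP => [/andP[h1 h2]|_ m _//]; rewrite mulrAC -mulrA.
have rib := ribbon_mv_down r_gt0 h1 h2.
rewrite -add1n; apply: fps_ord_geM => //; rewrite -[j]addn0.
apply: fps_ord_geM; last exact: fps_ord_ge0.
case: j nb => [|j] nb; first exact: fps_ord_ge0.
apply: vT; apply: contra nb => /(box_ribbon_up r_gt0 rib).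
by rewrite -addnA -mulnSr.
Qed.

Lemma spread_lower T y p v : spread T v -> spread T (down y p v).
Proof.
move=> vT j lam nb; apply: fps_ord_geD; first exact: vT.
case: ifP => [/andP[h1 h2]|_ m _//]; have rib := ribbon_mv_up r_gt0 h1 h2.
rewrite -[j.+1]add0n; apply: fps_ord_geM; first exact: fps_ord_ge0.
by apply: vT; apply: contra nb; apply: box_ribbon_down rib.
Qed.

Lemma spread_raises T x a m v :
  fps_ord_ge 1 x -> spread T v -> spread T (ups x a m v).
Proof. by move=> x1 vT; elim: m => //= m; apply: spread_raise. Qed.

Lemma spread_lowers T x a m v : spread T v -> spread T (downs x a m v).
Proof. by elim: m v => //= m IHm v vT; apply/IHm/spread_lower. Qed.

Section Window.
Variables (T d L : nat) (LT : (T + r * d + r <= L)%N).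
Let D (m : {cmonom I}) := (mdeg m < d.+1)%N.
(** The positions from [a] to [a + n - 1 = L - r] are those of the ribbons lying strictly between
    the diagonals [- L] and [L]. Modulo [D], spread vectors live in the box of side [T + r * d]; the
    extra [r] in [LT] makes room for [r] known positions at either end. *)
Let a : int := 1 - L%:Z.
Let n : nat := (L + L - r)%N.

Let rL : (r <= L)%N. Proof. by apply: leq_trans LT; apply: leq_addl. Qed.

Let spread_diag (c : nat -> A) (k : A) p v : spread T v ->
  (forall lam, box (L - r) lam -> c (window_beads r p lam) = k) ->
  vec_eqmod D (diag_op r c p v) (fun lam => k * v lam).
Proof.
move=> vT ck lam; rewrite /diag_op; have [/ck -> //|nb] := boolP (box (L - r) lam).
have v0 : fps_eqmod D (v lam) 0.
  apply: vT; apply: contra nb; rewrite !box_rowcount.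
  have := @rowcount_mono lam (T + r * d)%N%:Z (L - r)%N%:Z.
  have := @rowcount_lip lam (- (L - r)%N%:Z) (- (T + r * d)%N%:Z).
  lia.
have z q : fps_eqmod D (q * v lam) 0.
  rewrite -[X in fps_eqmod _ _ X](mulr0 q); apply: fps_eqmodM => //.
  exact: divisor_closed_mdeg.
exact: fps_eqmod_trans (z _) (fps_eqmod_sym (z _)).
Qed.

Lemma lowers_raises x y v : fps_ord_ge 1 x -> spread T v ->
  vec_eqmod D (downs y a n (ups x a n v))
    (fun lam => cauchy_factor x y r * ups x a n (downs y a n v) lam).
Proof.
move=> x1 vT lam; have Dc := @divisor_closed_mdeg I d.+1.
(* For partitions in the box of side [L - r], the [r] positions from [a] on are all occupied, which
   gives [C(r)]. *)
have bot : vec_eqmod D (diag_op r (cauchy_factor x y) a (downs y a n v))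
    (fun lam => cauchy_factor x y r * downs y a n v lam).
  apply: spread_diag => [|mu]; first exact: spread_lowers.
  rewrite box_rowcount /window_beads /a => /andP[_ h]; congr cauchy_factor.
  have -> : 1 - L%:Z - 1 = - L%:Z by lia.
  have -> : 1 - L%:Z + r%:Z - 1 = - (L - r)%N%:Z by lia.
  have := rowcount_ge mu (- L%:Z); have := rowcount_ge mu (- (L - r)%N%:Z).
  have := @rowcount_lip mu (- L%:Z) (- (L - r)%N%:Z).
  lia.
(* The [r] positions from [a + n] on are all empty, which gives [C(0) = 1]. *)
have top : vec_eqmod D (diag_op r (cauchy_factor x y) (a + n%:Z) (ups x a n v))
    (fun lam => 1 * ups x a n v lam).
  apply: spread_diag => [|mu]; first exact: spread_raises.
  rewrite box_rowcount /window_beads => /andP[/eqP h _].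
  have -> : a + n%:Z - 1 = (L - r)%N%:Z by rewrite /a /n; lia.
  by rewrite h sub0n /cauchy_factor big_ord0.
have {}top : vec_eqmod D (ups x a n v)
    (diag_op r (cauchy_factor x y) (a + n%:Z) (ups x a n v)).
  by move=> mu; apply: fps_eqmod_sym; have := top mu; rewrite mul1r.
apply: fps_eqmod_trans (lowers_eqmod Dc y a n top lam) _.
rewrite raises_diag_lowers//; last by move=> h; apply: cauchy_factorS.
by apply: fps_eqmod_trans (raises_eqmod Dc x a n bot lam) _; rewrite raises_scale.
Qed.

Variables (gam : intpart) (gam_core : is_core r gam) (gamT : box T gam).

(** The vector [U(x_{K-1}) ... U(x_0) gam], each [U] being cut to the window. *)
Fixpoint strip_vec (x : nat -> A) (K : nat) : intpart -> A :=
  if K is K'.+1 then ups (x K') a n (strip_vec x K')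
  else fun lam => (lam == gam)%:R.

Lemma spread_strip_vec (x : nat -> A) K : (forall i, fps_ord_ge 1 (x i)) -> spread T (strip_vec x K).
Proof.
move=> x1; elim: K => [|K IHK] /=; last exact: spread_raises.
move=> j lam; case: eqP => [->|_ _ m//]; case/negP.
by apply: contraTT gamT; rewrite /box; lia.
Qed.

(** Removing a ribbon from [gam] would give a partition below it, which by minimality is [gam]
    itself, whereas the counts differ on the diagonals of the ribbon. *)
Lemma lowers_core y : downs y a n (fun lam => (lam == gam)%:R) =
  fun lam => (lam == gam)%:R.
Proof.
elim: n => //= m IHm; rewrite -[RHS]IHm; congr downs; apply/funext => lam.
rewrite /lower; case: ifP => [/andP[h1 h2]|_]; last by rewrite addr0.
case: (mv _ _ _ =P gam) => [E|_]; last by rewrite mulr0 addr0.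
have rib := ribbon_mv_up r_gt0 h1 h2; rewrite E in rib.
have lamE : lam = gam.
  by apply: gam_core; apply: rt_step; apply/asboolP/is_ribbonP; exists (a + m%:Z).
have := rib (a + m%:Z); rewrite lamE; lia.
Qed.

Lemma lowers_strip_vec (x : nat -> A) y K : (forall i, fps_ord_ge 1 (x i)) ->
  vec_eqmod D (downs y a n (strip_vec x K))
    (fun lam => (\prod_(i < K) cauchy_factor (x i) y r) * strip_vec x K lam).
Proof.
move=> x1; have Dc := @divisor_closed_mdeg I d.+1.
elim: K => [|K IHK] lam /=; first by rewrite lowers_core big_ord0 mul1r.
apply: fps_eqmod_trans (lowers_raises _ (x1 K) (spread_strip_vec _ x1) lam) _.
rewrite big_ord_recr /= mulrAC mulrC; apply: fps_eqmodM => //.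
apply: fps_eqmod_trans (raises_eqmod Dc (x K) a n IHK lam) _.
by rewrite raises_scale.
Qed.

(** Jumps within the window preserve the box of side [L], so the adjunction holds for the finite sum
    over it. *)
Lemma strip_vec_adjoint x v w :
  \sum_(lam <- box_seq L) ups x a n w lam * v lam =
  \sum_(lam <- box_seq L) w lam * downs x a n v lam.
Proof.
apply: raises_adjoint; [by []|exact: uniq_box_seq|] => p pan lam.
rewrite !mem_box_seq => boxl.
case h1: (bead lam p); case h2: (bead lam (p + r%:Z)).
- by rewrite mv_id// h1 h2.
- have rib := ribbon_mv_up r_gt0 h1 (negbT h2).
  by rewrite -(@box_ribbon r p L lam)//; move: pan rL; rewrite /a /n; lia.
- have rib := ribbon_mv_down r_gt0 (negbT h1) h2.
  by rewrite (@box_ribbon r p L _ lam)//; move: pan rL; rewrite /a /n; lia.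
- by rewrite mv_id// h1 h2.
Qed.

(** Each [U(y_j)] moves to the other side as [D(y_j)], passes the [U(x_i)] at the cost of the Cauchy
    factors and is absorbed by the core. With no [y_j] left, the same adjunction removes the
    [U(x_i)] and leaves 1. *)
Lemma strip_vec_cauchy (x y : nat -> A) K J :
  (forall i, fps_ord_ge 1 (x i)) -> (forall i, fps_ord_ge 1 (y i)) ->
  fps_eqmod D (\sum_(lam <- box_seq L) strip_vec x K lam * strip_vec y J lam)
    (\prod_(j < J) \prod_(i < K) cauchy_factor (x i) (y j) r).
Proof.
move=> x1 y1; have Dc := @divisor_closed_mdeg I d.+1.
have gamL : gam \in box_seq L.
  by rewrite mem_box_seq; move: gamT; rewrite /box; lia.
have delta w : \sum_(lam <- box_seq L) w lam * (lam == gam)%:R = w gam :> A.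
  rewrite (big_rem gam)//= eqxx mulr1 big1_seq ?addr0// => lam /andP[_].
  by rewrite mem_rem_uniq ?uniq_box_seq// inE => /andP[/negbTE -> _]; rewrite mulr0.
elim: J => [|J IHJ].
  rewrite big_ord0; suff -> : \sum_(lam <- box_seq L) strip_vec x K lam *
    (lam == gam)%:R = 1 by [].
  elim: K => [|K IHK]; first by rewrite delta /= eqxx.
  by rewrite (strip_vec_adjoint (x K) (fun lam => (lam == gam)%:R)) lowers_core.
rewrite /=.
rewrite (eq_bigr (fun lam => ups (y J) a n (strip_vec y J) lam * strip_vec x K lam));
  last by move=> lam _; rewrite mulrC.
rewrite strip_vec_adjoint big_ord_recr /=.
apply: (@fps_eqmod_trans _ _ _ (\sum_(lam <- box_seq L) (strip_vec y J lam *
  ((\prod_(i < K) cauchy_factor (x i) (y J) r) * strip_vec x K lam)))).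
  by apply: fps_eqmod_sum => lam _; apply: fps_eqmodM => //; apply: lowers_strip_vec.
rewrite (eq_bigr (fun lam => (\prod_(i < K) cauchy_factor (x i) (y J) r) *
  (strip_vec x K lam * strip_vec y J lam))); last by move=> lam _; rewrite mulrC -mulrA.
rewrite -mulr_sumr mulrC.
exact: fps_eqmodM.
Qed.

End Window.
End Cauchy.

(** * Horizontal strips as terms of the expanded strip operators *)

Section Strips.
Variables (r : nat) (r_gt0 : (0 < r)%N).
Implicit Types (lam mu kap : intpart) (p : int) (c : seq intpart).

Definition heads kap c : seq int :=
  pairmap (fun a b => square_content (ribbon_head a b)) kap c.

(* Pairs [(kap, c)] where [c] is a chain of ribbons from [kap] to [lam] whose
   beads jump from increasing positions in the interval [a, a + m - 1]. *)
Fixpoint chains (a : int) (m : nat) lam : seq (intpart * seq intpart) :=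
  if m is m'.+1 then
    chains a m' lam ++
    (if ~~ bead lam (a + m'%:Z) && bead lam (a + m'%:Z + r%:Z)
     then [seq (C.1, rcons C.2 lam) | C <- chains a m' (mv r (a + m'%:Z) lam)]
     else [::])
  else [:: (lam, [::])].

Lemma pairmap_rcons (T U : Type) (f : T -> T -> U) x s y :
  pairmap f x (rcons s y) = rcons (pairmap f x s) (f (last x s) y).
Proof. by rewrite -cats1 pairmap_cat /= cats1. Qed.

Lemma strip_chain_rcons kap c mu lam :
  strip_chain r kap lam (rcons c mu) <->
  [/\ mu = lam, strip_chain r kap (last kap c) c, prec r (last kap c) lam &
      all (fun h => h < square_content (ribbon_head (last kap c) lam)) (heads kap c)].
Proof.
rewrite /strip_chain rcons_path last_rcons pairmap_rcons.
rewrite !(sorted_pairwise lt_trans) pairwise_rcons.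
split=> [[/andP[h1 h2] E /andP[h3 h4]]|[-> [h1 _ h2] h3 h4]].
  by rewrite -E; split=> //; split.
by split=> //; [apply/andP | apply/andP; split].
Qed.

Lemma chains_sound a m lam C : C \in chains a m lam ->
  strip_chain r C.1 lam C.2 /\
  all (fun h => h < a + m%:Z + r%:Z - 1) (heads C.1 C.2).
Proof.
elim: m lam C => [|m IHm] lam C /=; first by rewrite inE => /eqP ->.
rewrite mem_cat => /orP[/IHm[h1 h2]|].
  by split=> //; apply: sub_all h2 => h; lia.
case: ifP => // /andP[h1 h2] /mapP[C' /IHm[h3 h4] ->] /=.
have rib := ribbon_mv_down r_gt0 h1 h2; have [_ h5 _] := h3.
have hd := ribbon_head_at r_gt0 rib; split.
  apply/strip_chain_rcons; rewrite h5; split=> //.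
        by apply/asboolP/is_ribbonP; exists (a + m%:Z).
  by rewrite hd.
rewrite /heads pairmap_rcons all_rcons h5 hd; apply/andP; split; first by lia.
by apply: sub_all h4 => h; lia.
Qed.

Lemma chains_complete a m kap c lam : strip_chain r kap lam c ->
  all (fun h => a + r%:Z - 1 <= h < a + m%:Z + r%:Z - 1) (heads kap c) ->
  (kap, c) \in chains a m lam.
Proof.
elim: m kap c lam => [|m IHm] kap c lam /=.
  case: c => [|mu c] /=; first by case=> _ /= -> _; rewrite inE.
  by move=> _ /andP[]; lia.
rewrite mem_cat; have [h1 ch _|h1 ch h2] :=
    boolP (all (fun h => a + r%:Z - 1 <= h < a + m%:Z + r%:Z - 1) (heads kap c)).
  by rewrite IHm.
apply/orP; right; case: (lastP c) ch h1 h2 => [//|{}c mu].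
move=> /strip_chain_rcons[-> h1 /asboolP/is_ribbonP[p rib] h3] h4.
have hd := ribbon_head_at r_gt0 rib.
rewrite /heads pairmap_rcons all_rcons hd => /andP[pm h5].
(* As heads increase, a head beyond the smaller range forces the last one to be beyond it, so the
   last jump starts at [a + m]. *)
have pE : p = a + m%:Z.
  apply/eqP; apply: contraR h4 => pam; rewrite /heads pairmap_rcons all_rcons hd.
  apply/andP; split; first by lia.
  move: h3 h5; rewrite hd => /allP h3 /allP h5; apply/allP => h hin.
  by have := h3 _ hin; have := h5 _ hin; lia.
have [_ _ b1 b2] := ribbon_bead r_gt0 rib; rewrite -pE b1 b2 /=.
apply/mapP; exists (kap, c) => //=.
rewrite (mv_eq_down r_gt0 rib); apply: IHm => //.
move: h3 h5; rewrite hd pE => /allP h3 /allP h5; apply/allP => h hin.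
by have := h3 _ hin; have := h5 _ hin; lia.
Qed.

Lemma chains_rowcount a m lam C k : C \in chains a m lam ->
  a + m%:Z + r%:Z - 1 <= k -> rowcount C.1 k = rowcount lam k.
Proof.
elim: m lam C => [|m IHm] lam C /=; first by rewrite inE => /eqP ->.
rewrite mem_cat => /orP[/IHm h mk|]; first by apply: h; lia.
case: ifP => // /andP[h1 h2] /mapP[C' /IHm h ->] /= mk.
rewrite h; last by lia.
by rewrite [in RHS](ribbon_mv_down r_gt0 h1 h2); lia.
Qed.

(** Among jumps from positions up to [a + m], only the one from [a + m] affects diagonal
    [a + m + r - 1]. The count of the lower end there tells the two branches of the recursion apart,
    so a chain is determined by its ends. *)
Lemma uniq_chains a m lam : uniq [seq C.1 | C <- chains a m lam].
Proof.
elim: m lam => //= m IHm lam; rewrite map_cat cat_uniq IHm /=.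
case: ifP => //= /andP[h1 h2]; rewrite -map_comp.
rewrite (eq_map (g := fst)); last by [].
rewrite IHm andbT; apply/hasPn => kap /mapP[C CC ->]; apply/mapP => -[C' CC' /= E].
have h3 := chains_rowcount CC (lexx _); have h4 := chains_rowcount CC' (lexx _).
have := ribbon_mv_down r_gt0 h1 h2 (a + m%:Z + r%:Z - 1).
by rewrite -h3 E h4; lia.
Qed.

(** When the product is expanded, a chain records the positions where [x u_p] is chosen rather than
    1, and its heights add up to the exponent of [t]. *)
Lemma raises_chains (A : comNzRingType) (t x : A) a m v lam :
  raises r t x a m v lam = \sum_(C <- chains a m lam)
    t ^+ sumn (pairmap ribbon_height C.1 C.2) * x ^+ size C.2 * v C.1.
Proof.
elim: m lam => [|m IHm] lam /=; first by rewrite big_seq1 /= !expr0 !mul1r.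
rewrite /raise IHm big_cat; congr (_ + _).
case: ifP => [/andP[h1 h2]|_]; last by rewrite big_nil.
rewrite IHm big_map mulr_sumr big_seq [RHS]big_seq; apply: eq_bigr => C CC /=.
have [[_ h5 _] _] := chains_sound CC; have rib := ribbon_mv_down r_gt0 h1 h2.
rewrite pairmap_rcons sumn_rcons size_rcons h5 (ribbon_height_at r_gt0 rib).
rewrite -(leg_mv r_gt0) exprD exprS.
by move: (t ^+ leg _ _ _) (t ^+ sumn _) (x ^+ _) (v _) => u1 u2 u3 u4; ring.
Qed.

Section Window.
Variable L : nat.
Let a : int := 1 - L%:Z.
Let n : nat := (L + L - r)%N.

(** Otherwise the ribbon would put a bead beyond [L] or leave a position at or below [- L] empty.
    Hence the window sees every strip ending in the box. *)
Lemma ribbon_box p kap lam : ribbon_at r p kap lam -> box L lam ->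
  - L%:Z < p /\ p + r%:Z <= L%:Z.
Proof.
move=> rib; rewrite box_rowcount => /andP[/eqP top bot].
have [_ _] := ribbon_bead r_gt0 rib; rewrite /bead => b1 b2; split.
  rewrite ltNge; apply/negP => pL.
  have := rowcount_ge lam (p - 1); have := @rowcount_lip lam p (- L%:Z); lia.
rewrite leNgt; apply/negP => pL.
have : (rowcount lam (p + r%:Z - 1)%R <= rowcount lam L%:Z)%N by apply: rowcount_mono; lia.
lia.
Qed.

Lemma strip_chain_box kap lam c : strip_chain r kap lam c -> box L lam ->
  box L kap /\ all (fun h => r%:Z - L%:Z <= h < L%:Z) (heads kap c).
Proof.
elim/last_ind: c lam => [|c mu IHc] lam; first by case=> _ /= ->.
move=> /strip_chain_rcons[-> h1 /asboolP/is_ribbonP[p rib] _] boxl.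
have [pL Lp] := ribbon_box rib boxl; have hd := ribbon_head_at r_gt0 rib.
have [bk hs] := IHc _ h1 (box_ribbon_down rib boxl); split=> //.
by rewrite /heads pairmap_rcons all_rcons hd hs andbT; lia.
Qed.

Lemma mem_chains kap lam c : box L lam ->
  (kap, c) \in chains a n lam <-> strip_chain r kap lam c.
Proof.
move=> boxl; split=> [/chains_sound[]//|ch]; apply: chains_complete => //.
have [_] := strip_chain_box ch boxl; apply: sub_all => h.
by rewrite /a /n; lia.
Qed.

(** Entries of [chains] are separated by their lower ends, so the chain chosen by [xget] is the one
    listed. *)
Lemma the_chainP kap lam c : box L lam -> (kap, c) \in chains a n lam ->
  the_chain r kap lam = c.
Proof.
move=> boxl kc; rewrite /the_chain; case: xgetP => [c' _ /= ch|/(_ c)[]]; last first.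
  by apply/mem_chains.
have /(mem_chains _ _ boxl) kc' := ch.
have := uniq_chains a n lam => /(uniqP (kap)) inj.
have nthE := fun d i (h : (i < size (chains a n lam))%N) => nth_map (kap, c) kap fst h.
have i1 := kc; have i2 := kc'; rewrite -!index_mem in i1 i2.
have := inj (index (kap, c) (chains a n lam)) (index (kap, c') (chains a n lam)).
rewrite !inE !size_map !(nth_map (kap, c)) ?nth_index// => /(_ i1 i2 erefl) E.
by have := nth_index (kap, c) kc'; rewrite -E nth_index// => -[].
Qed.

Definition strips_below lam : seq intpart := [seq C.1 | C <- chains a n lam].

Lemma mem_strips_below kap lam : box L lam ->
  kap \in strips_below lam <-> horizontal_strip r kap lam.
Proof.
move=> boxl; split=> [/mapP[[k c] kc ->]|[c /(mem_chains _ _ boxl) kc]].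
  by exists c; apply/mem_chains.
by apply/mapP; exists (kap, c).
Qed.

Lemma uniq_strips_below lam : uniq (strips_below lam).
Proof. exact: uniq_chains. Qed.

Lemma box_strip kap lam : box L lam -> horizontal_strip r kap lam -> box L kap.
Proof. by move=> boxl [c /strip_chain_box[]]. Qed.

Lemma raises_strips (A : comNzRingType) (t x : A) v lam : box L lam ->
  raises r t x a n v lam = \sum_(kap <- strips_below lam)
    t ^+ twice_spin r kap lam * x ^+ strip_size r kap lam * v kap.
Proof.
move=> boxl; rewrite raises_chains /strips_below big_map big_seq [RHS]big_seq.
apply: eq_bigr => -[kap c] kc /=.
by rewrite /twice_spin /strip_size (the_chainP boxl kc).
Qed.

End Window.

Lemma box_exists lam : exists L, box L lam.
Proof. by exists (part lam 0 + size lam)%N; rewrite /box leq_addr leq_addl. Qed.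

Lemma the_chain_strip kap lam : horizontal_strip r kap lam ->
  strip_chain r kap lam (the_chain r kap lam).
Proof. by case=> c ch; rewrite /the_chain; case: xgetP => [c' _ //|/(_ c)]. Qed.

Lemma the_chain_refl lam : the_chain r lam lam = [::].
Proof.
have [L boxl] := box_exists lam.
by apply: (the_chainP boxl); apply/mem_chains.
Qed.

Lemma strip_refl lam : horizontal_strip r lam lam.
Proof. by exists [::]. Qed.

Lemma strip_size_eq0 kap lam : horizontal_strip r kap lam ->
  strip_size r kap lam = 0%N -> kap = lam.
Proof.
by move=> /the_chain_strip; rewrite /strip_size; case: the_chain => // -[].
Qed.

Lemma strip_ribbon_le kap lam : horizontal_strip r kap lam -> ribbon_le r kap lam.
Proof.
case=> c [cp <- _] {lam}; elim: c kap cp => [|mu c IHc] kap /=; first by move=> _; apply: rt_refl.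
by move=> /andP[h1 h2]; apply: rt_trans (rt_step _ _ _ _ h1) (IHc _ h2).
Qed.

End Strips.

(** * Ribbon tableaux and their generating series *)

Section Tableaux.
Variables (r : nat) (r_gt0 : (0 < r)%N) (I : choiceType) (gam : intpart).
Local Notation A := (fps {poly int} I).
Variable x : nat -> A.
Implicit Types (lam kap : intpart) (P : nat -> intpart).

Definition tableau_term P : A :=
  fpsC (qhalf ^+ tableau_twice_spin r P) * tableau_weight r P x.

Lemma fsbig_nat (T : Type) (idx : T) (op : Monoid.com_law idx) (K : nat)
    (F : nat -> T) :
  (forall j, (K <= j)%N -> F j = idx) ->
  \big[op/idx]_(j \in [set: nat]) F j = \big[op/idx]_(j < K) F j.
Proof.
move=> F0; rewrite fsbig_ord; apply/esym/fsbig_widen => // j [_ /= nj].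
by apply: F0; rewrite leqNgt; apply/negP.
Qed.

Lemma tableau_term_prod P K : (forall j, (K <= j)%N -> P j = P j.+1) ->
  tableau_term P = \prod_(j < K)
    (fpsC qhalf ^+ twice_spin r (P j) (P j.+1) * x j ^+ strip_size r (P j) (P j.+1)).
Proof.
move=> PK; rewrite /tableau_term big_split /=; congr (_ * _).
  rewrite prodrXr -fpsC_exp; congr (_ ^+ _); apply: fsbig_nat => j /PK <-.
  by rewrite /twice_spin the_chain_refl.
apply: fsbig_nat => j /PK <-.
by rewrite /strip_size the_chain_refl// expr0.
Qed.

Definition extend (K : nat) P lam : nat -> intpart :=
  fun j => if (j <= K)%N then P j else lam.

Section Window.
Variable L : nat.

Fixpoint tableaux (K : nat) lam : seq (nat -> intpart) :=
  if K is K'.+1 then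
    [seq extend K' P lam | kap <- strips_below r L lam, P <- tableaux K' kap]
  else if lam == gam then [:: fun=> gam] else [::].

Definition tableau_upto (K : nat) lam P : Prop :=
  [/\ P 0%N = gam, forall j, horizontal_strip r (P j) (P j.+1) &
      forall j, (K <= j)%N -> P j = lam].

Lemma mem_tableaux K lam P : box L lam ->
  P \in tableaux K lam <-> tableau_upto K lam P.
Proof.
elim: K lam P => [|K IHK] lam P boxl /=.
  case: eqP => [->|nl]; split.
  - by rewrite inE => /eqP ->; split=> // j; apply: strip_refl.
  - case=> _ _ Pg; rewrite inE; apply/eqP/funext => j; exact: Pg.
  - by rewrite in_nil.
  - by case=> P0 _ /(_ 0%N isT); rewrite P0 => /esym.
split=> [/allpairsPdep[kap [Q [kl Qk ->]]]|[P0 Ps PK]].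
  have ks : horizontal_strip r kap lam by apply/(mem_strips_below r_gt0 _ boxl).
  have [Q0 Qs QK] := (IHK _ _ (box_strip r_gt0 boxl ks)).1 Qk.
  rewrite /extend; split=> [//|j|j Kj]; last by rewrite leqNgt Kj.
  have [jK|Kj|->] := ltngtP j K.
  - exact: Qs.
  - exact: strip_refl.
  - by rewrite QK.
have ks : horizontal_strip r (P K) lam by rewrite -(PK K.+1).
(* The first [K] steps of [P], frozen at [P K], form a tableau to which the induction hypothesis
   applies. *)
apply/allpairsPdep; exists (P K), (extend K P (P K)); split.
- by apply/(mem_strips_below r_gt0 _ boxl).
- apply/IHK; first exact: box_strip ks.
  rewrite /extend; split=> [//|j|j Kj]; last first.
    by case: leqP => // jK; congr P; apply/eqP; rewrite eqn_leq jK.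
  have [jK|Kj|->] := ltngtP j K.
  - exact: Ps.
  - exact: strip_refl.
  - exact: strip_refl.
- apply/funext => j; rewrite /extend; case: leqP => // Kj; exact: PK.
Qed.

Lemma uniq_tableaux K lam : box L lam -> uniq (tableaux K lam).
Proof.
elim: K lam => [|K IHK] lam boxl /=; first by case: eqP.
have box_kap kap : kap \in strips_below r L lam -> box L kap.
  by move=> /(mem_strips_below r_gt0 _ boxl) /(box_strip r_gt0 boxl).
apply: allpairs_uniq_dep => [|kap kl|].
- exact: uniq_strips_below.
- exact/IHK/box_kap.
move=> /= _ _ /allpairsPdep[kap [P [kl Pk ->]]] /allpairsPdep[kap' [P' [kl' Pk' ->]]] /=.
have [_ _ PK] := (mem_tableaux K P (box_kap _ kl)).1 Pk.
have [_ _ PK'] := (mem_tableaux K P' (box_kap _ kl')).1 Pk'.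
move=> E; have PE j : (j <= K)%N -> P j = P' j.
  by move=> jK; have := congr1 (fun Q => Q j) E; rewrite /extend jK.
have kk : kap = kap' by rewrite -(PK K)// -(PK' K)// PE.
rewrite -kk in PK' *; congr existT; apply/funext => j.
by have [/PE//|/ltnW Kj] := leqP j K; rewrite PK// PK'.
Qed.

Lemma sum_tableaux K lam : box L lam ->
  \sum_(P <- tableaux K lam) tableau_term P = strip_vec r qhalf L gam x K lam.
Proof.
elim: K lam => [|K IHK] lam boxl /=.
  case: eqP => _; last by rewrite big_nil.
  by rewrite big_seq1 (@tableau_term_prod _ 0)// big_ord0.
rewrite big_allpairs_dep raises_strips// big_seq [RHS]big_seq.
apply: eq_bigr => kap /(mem_strips_below r_gt0 _ boxl) ks.
have boxk := box_strip r_gt0 boxl ks.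
rewrite -(IHK _ boxk) mulr_sumr big_seq [RHS]big_seq; apply: eq_bigr => P.
move=> /(mem_tableaux K P boxk)[P0 Ps PK].
rewrite (@tableau_term_prod _ K.+1); last first.
  by move=> j Kj; rewrite /extend !ifF//; lia.
rewrite (@tableau_term_prod P K); last by move=> j Kj; rewrite !PK// leqW.
rewrite big_ord_recr /= [LHS]mulrC /extend leqnn ltnn PK//; congr (_ * _).
by apply: eq_bigr => j _; rewrite (ltnW (ltn_ord j)) ltn_ord.
Qed.

(** A tableau that still changes at some step [j >= K] carries a factor [x j], which vanishes modulo
    [D]; the others are those listed in [tableaux]. *)
Lemma ribbonG_eqmod (D : {cmonom I} -> Prop) K lam : divisor_closed D ->
  (forall j, (K <= j)%N -> fps_eqmod D (x j) 0) -> box L lam ->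
  fps_eqmod D (ribbonG r lam gam x) (strip_vec r qhalf L gam x K lam).
Proof.
move=> Dc xK boxl m Dm; rewrite -sum_tableaux// fps_coef_sum /=.
rewrite (@fsbigE _ _ _ _ _ (tableaux K lam)) ?uniq_tableaux//.
- rewrite big_seq_cond [RHS]big_seq; apply: eq_bigl => P.
  case: (boolP (P \in tableaux K lam)) => //= /(mem_tableaux K P boxl)[P0 Ps PK].
  by apply/mem_set; split=> //; exists K.
- by move=> P /= /(mem_tableaux K P boxl)[P0 Ps PK]; split=> //; exists K.
move=> P /= [P0 Ps [n Pn]] PT.
have [j Kj Pj] : exists2 j, (K <= j)%N & P j <> P j.+1.
  apply: contrapT => nj; case/negP: PT; apply/(mem_tableaux K P boxl).
  split=> // j Kj; have PS i : (K <= i)%N -> P i = P i.+1.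
    by move=> Ki; apply: contrapT => Pi; apply: nj; exists i.
  have PC i : P (K + i)%N = P K.
    by elim: i => [|i <-]; rewrite ?addn0// addnS -PS// leq_addr.
  by rewrite -(subnKC Kj) PC -(PC n) Pn// leq_addl.
pose N := (n + j.+1)%N.
change (fps_coef (tableau_term P) m = 0).
rewrite (@tableau_term_prod P N); last first.
  by move=> i Ni; rewrite !Pn//; rewrite /N in Ni; lia.
have jN : (j < N)%N by rewrite /N; lia.
rewrite (bigD1 (Ordinal jN))//; set rest := \prod_(_ < _ | _) _.
change (fps_coef (fpsC qhalf ^+ twice_spin r (P j) (P j.+1) *
  x j ^+ strip_size r (P j) (P j.+1) * rest) m = 0).
have sz : strip_size r (P j) (P j.+1) != 0%N.
  by apply/eqP => /(strip_size_eq0 (Ps j)).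
case: (strip_size _ _ _) sz => // s _; rewrite exprS mulrCA -mulrA.
have H : fps_eqmod D (x j * (fpsC qhalf ^+ twice_spin r (P j) (P j.+1) * x j ^+ s * rest))
    (0 * (fpsC qhalf ^+ twice_spin r (P j) (P j.+1) * x j ^+ s * rest)).
  by apply: fps_eqmodM => //; apply: xK.
by rewrite H// mul0r.
Qed.

End Window.

Lemma ribbonG_RH lam : ~ RH r gam lam -> ribbonG r lam gam x = 0.
Proof.
move=> nl; apply: fpsP => m /=; apply: fsbig1 => P [P0 Ps [n Pn]].
case: nl; rewrite /RH /= -(Pn n)// -P0.
elim: n {Pn} => [|n IHn]; first exact: rt_refl.
exact: rt_trans IHn (strip_ribbon_le (Ps n)).
Qed.

End Tableaux.

(** * From finite windows to the infinite identity *)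

Lemma fpsX_eqmod0 (R : comNzRingType) (I : choiceType) (D : {cmonom I} -> Prop) i :
  (forall m, D m -> m i = 0%N) -> fps_eqmod D (fpsX i : fps R I) 0.
Proof.
by move=> Di m /Di mi /=; case: eqP mi => // ->; rewrite cmUU.
Qed.

Lemma fps_has_prod_eq (R : comNzRingType) (I T : choiceType) (F : T -> fps R I) p :
  fps_has_prod F p -> fps_prod F = p.
Proof.
move=> Fp; rewrite /fps_prod; case: xgetP => [p' _ Fp'|/(_ p)//].
apply: fpsP => m; have [S SE] := Fp m; have [S' SE'] := Fp' m.
by rewrite -(SE (S `|` S')%fset) ?fsubsetUl// (SE' (S `|` S')%fset)// fsubsetUr.
Qed.

Lemma monomial_bound (m : {cmonom (nat + nat)%type}) :
  exists K, forall i, (K <= i)%N -> m (inl i) = 0%N /\ m (inr i) = 0%N.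
Proof.
pose f (s : nat + nat) := match s with inl i => i | inr i => i end.
exists (\max_(s <- finsupp m) f s).+1 => i Ki.
have h s : f s = i -> m s = 0%N.
  move=> fs; apply/eqP; rewrite cmE_eq0; apply/negP => sm.
  have : (f s <= \max_(s <- finsupp m) f s)%N by apply: leq_bigmax_seq.
  rewrite fs; move: Ki.
  by rewrite ltnNge => /negP.
by split; apply: h.
Qed.

Section RibbonCauchy.
Variables (r : nat) (gam : intpart).
Variables (r_gt0 : (0 < r)%N) (gam_core : is_core r gam).
Local Notation A := (fps {poly int} (nat + nat)%type).
Let X (i : nat) : A := fpsX (inl i).
Let Y (j : nat) : A := fpsX (inr j).
Let q : A := fpsC (qhalf ^+ 2).
Let factor (ij : nat * nat) : A := \prod_(k < r) (1 - q ^+ k * X ij.1 * Y ij.2)^-1.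
Let term (lam : intpart) : A := ribbonG r lam gam X * ribbonG r lam gam Y.

(** Only monomials of degree at most [d] in the indeterminates of index below [K] are kept; modulo
    the others all sums and products become finite. *)
Let bounded (d K : nat) (m : {cmonom (nat + nat)%type}) : Prop :=
  (mdeg m < d.+1)%N /\ forall i, (K <= i)%N -> m (inl i) = 0%N /\ m (inr i) = 0%N.

Let bounded_closed d K : divisor_closed (bounded d K).
Proof.
move=> a b [dab vab]; split.
  by apply: leq_ltn_trans dab; rewrite mdegM leq_addr.
by move=> i /vab; rewrite !cmM; lia.
Qed.

Let X0 d K i : (K <= i)%N -> fps_eqmod (bounded d K) (X i) 0.
Proof. by move=> Ki; apply: fpsX_eqmod0 => m [_ /(_ _ Ki)[]]. Qed.

Let Y0 d K i : (K <= i)%N -> fps_eqmod (bounded d K) (Y i) 0.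
Proof. by move=> Ki; apply: fpsX_eqmod0 => m [_ /(_ _ Ki)[]]. Qed.

Let X1 i : fps_ord_ge 1 (X i). Proof. exact: fps_ord_geX. Qed.
Let Y1 i : fps_ord_ge 1 (Y i). Proof. exact: fps_ord_geX. Qed.

Let factor1 d K i j : (K <= i)%N || (K <= j)%N ->
  fps_eqmod (bounded d K) (factor (i, j)) 1.
Proof.
move=> Kij; have Dc := @bounded_closed d K.
have E1 : 1 = \prod_(k < r) 1 :> A by rewrite big1.
rewrite [X in fps_eqmod _ _ X]E1.
apply: fps_eqmod_prod => // k _; apply: fps_eqmod_inv => //; first exact: ord_cauchy.
case/orP: Kij => [Ki|Kj] /=.
  rewrite -[X in fps_eqmod _ _ X](mul0r (Y j)); apply: fps_eqmodM => //.
  by rewrite -[X in fps_eqmod _ _ X](mulr0 (q ^+ k)); apply: fps_eqmodM => //; apply: X0.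
rewrite -[X in fps_eqmod _ _ X](mulr0 (q ^+ k * X i)).
by apply: fps_eqmodM => //; apply: Y0.
Qed.

Let term0 T d L K lam : box T gam -> (T + r * d + r <= L)%N -> ~~ box L lam ->
  fps_eqmod (bounded d K) (term lam) 0.
Proof.
move=> gamT LT nb; have [L0 boxl] := box_exists lam.
(* The comparison with [strip_vec] needs a box containing [lam], hence the larger [L']; the
   vanishing then follows from the spread bound, which is the same for every window. *)
pose L' := (L0 + L)%N; have boxL' : box L' lam by move: boxl; rewrite /box /L'; lia.
have Dc := @bounded_closed d K.
rewrite -[X in fps_eqmod _ _ X](mul0r (ribbonG r lam gam Y)).
apply: fps_eqmodM => //.
apply: fps_eqmod_trans (ribbonG_eqmod r_gt0 gam Dc (@X0 d K) boxL') _.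
have LT' : (T + r * d + r <= L')%N by apply: leq_trans LT (leq_addl _ _).
move=> m [md _]; have H := spread_strip_vec r_gt0 qhalf LT' gamT K X1.
apply: (H d) => //; apply: contra nb; rewrite /box; lia.
Qed.

Lemma term_bounded m : exists B, forall lam,
  fps_coef (term lam) m != 0 -> box B lam.
Proof.
have [T gamT] := box_exists gam; have [K mK] := monomial_bound m.
exists (T + r * mdeg m + r)%N => lam; apply: contraR => nb.
by rewrite (term0 gamT (leqnn _) nb (K := K)).
Qed.

(** For the coefficient at [m] only partitions in the box of side [L] matter; there both series
    agree with [strip_vec], whose pairing is the finite Cauchy product. *)
Lemma ribbon_cauchy_coef m : exists K0, forall K, (K0 <= K)%N ->
  fps_coef (fps_sum (RH r gam) term) m =
  fps_coef (\prod_(j < K) \prod_(i < K) factor (val i, val j)) m.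
Proof.
have [T gamT] := box_exists gam; have [K0 mK0] := monomial_bound m.
exists K0 => K K0K; pose d := mdeg m; pose L := (T + r * d + r)%N.
have Dm : bounded d K m by split=> // i Ki; apply: mK0; apply: leq_trans Ki.
have Dc := @bounded_closed d K.
have := strip_vec_cauchy r_gt0 qhalf (leqnn L) gam_core gamT K K X1 Y1.
move=> /(_ m (ltnSn _)) <-.
rewrite [LHS](@fsbigE _ _ _ _ _ [seq lam <- box_seq L | `[< RH r gam lam >]]).
- rewrite big_filter_cond fps_coef_sum big_mkcond big_seq [RHS]big_seq.
  apply: eq_bigr => lam; rewrite mem_box_seq => boxl.
  have E : fps_eqmod (bounded d K) (term lam)
      (strip_vec r qhalf L gam X K lam * strip_vec r qhalf L gam Y K lam).
    by apply: fps_eqmodM => //; apply: ribbonG_eqmod => //; [exact: X0 | exact: Y0].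
  (* Partitions of the box outside [RH r gam] contribute zero, so the sum may run over the whole
     box. *)
  rewrite -E//; case: ifPn => //; case: (boolP `[< RH r gam lam >]) => [/asboolP h|/asboolPn h _].
    by rewrite mem_set.
  have t0 := ribbonG_RH X h.
  have t1 : term lam = 0 :=
    etrans (congr1 (fun g => g * ribbonG r lam gam Y) t0) (mul0r _).
  by rewrite t1.
- by rewrite filter_uniq// uniq_box_seq.
- by move=> lam /=; rewrite mem_filter => /andP[/asboolP].
move=> lam hl; rewrite mem_filter asboolT//= mem_box_seq => nb.
exact: (term0 gamT (leqnn _) nb Dm).
Qed.

(** Once [S] contains all pairs of indices below [K], every further factor involves an indeterminate
    of index at least [K] and acts as 1 on the coefficient at [m]. *)
Lemma ribbon_cauchy : fps_has_prod factor (fps_sum (RH r gam) term).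
Proof.
move=> m; have [K1 mK1] := monomial_bound m; have [K2 mK2] := ribbon_cauchy_coef m.
pose K := maxn K1 K2; pose s := [seq (i, j) | j <- iota 0 K, i <- iota 0 K].
have us : uniq s.
  by rewrite allpairs_uniq ?iota_uniq// => -[a b] [c e] _ _ [-> ->].
have ms ij : (ij \in s) = (ij.1 < K)%N && (ij.2 < K)%N.
  apply/allpairsP/andP => [[[j i] /= [jK iK ->]]|[]].
    by move: jK iK; rewrite !mem_iota /=; lia.
  by case: ij => i j /= iK jK; exists (j, i); rewrite !mem_iota /=; split=> //; lia.
exists [fset ij in s]%fset => S sS; rewrite (mK2 K) ?leq_maxr//.
pose d := mdeg m.
have Dm : bounded d K m.
  by split=> // i Ki; apply: mK1; apply: leq_trans Ki; apply: leq_maxl.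
have -> : \prod_(j < K) \prod_(i < K) factor (val i, val j) = \prod_(ij <- s) factor ij.
  rewrite /s big_allpairs_dep -(big_mkord xpredT (fun j => \prod_(i < K) factor (val i, j))).
  rewrite /index_iota subn0; apply: eq_bigr => j _.
  by rewrite -(big_mkord xpredT (fun i => factor (i, j))) /index_iota subn0.
have -> : \prod_(ij <- S) factor ij =
    \prod_(ij <- s) factor ij * \prod_(ij <- S | ij \notin s) factor ij.
  rewrite (bigID (mem s)) /=; congr (_ * _); rewrite -big_filter; apply: perm_big.
  apply: uniq_perm => //; first by rewrite filter_uniq// fset_uniq.
  move=> ij; rewrite mem_filter andb_idr// => ijs.
  by apply: (fsubsetP sS); rewrite !inE.
have Dc := @bounded_closed d K.
have H : fps_eqmod (bounded d K)
    (\prod_(ij <- s) factor ij * \prod_(ij <- S | ij \notin s) factor ij)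
    (\prod_(ij <- s) factor ij * 1).
  apply: fps_eqmodM => //.
  have E1 : 1 = \prod_(ij <- S | ij \notin s) 1 :> A by rewrite big1.
  rewrite [X in fps_eqmod _ _ X]E1.
  apply: fps_eqmod_prod => // -[i j] ns; apply: factor1.
  by move: ns; rewrite ms /=; lia.
by rewrite (H m Dm) mulr1.
Qed.

End RibbonCauchy.

Unset Implicit Arguments.

Theorem mainTheorem5 (r : nat) (gam : intpart)
    (r_gt0 : (0 < r)%N) (gam_core : is_core r gam) :
  let X := fun i : nat => fpsX (inl i) : fps {poly int} (nat + nat)%type in
  let Y := fun j : nat => fpsX (inr j) : fps {poly int} (nat + nat)%type in
  let q := fpsC (qhalf ^+ 2) : fps {poly int} (nat + nat)%type in
  let factor := fun ij : nat * nat =>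
    \prod_(k < r) (1 - q ^+ k * X ij.1 * Y ij.2)^-1 in
  let term := fun lam : intpart => ribbonG r lam gam X * ribbonG r lam gam Y in
  [/\ fps_multipliable factor,
      fps_summable (RH r gam) term &
      fps_prod factor = fps_sum (RH r gam) term].
Proof.
move=> X Y q factor term; have prodE := ribbon_cauchy r_gt0 gam_core; split.
- by eexists; exact: prodE.
- move=> m; have [B termB] := term_bounded gam r_gt0 m.
  by apply: sub_finite_set (finite_box B) => lam [_ /termB].
- exact: fps_has_prod_eq prodE.
Qed.
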